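(* Let the random graph $\mathcal{G}=(V,E)$ and the process $\sigma$ be as in the context, and suppose that the following conditions hold. (i) For each vertex $x\in\mathbb{Z}^2$ there is a Poisson process $P_x$, and the processes $\{P_x\}_{x\in\mathbb{Z}^2}$ are mutually independent. Denoting by $\Upsilon_x=\{t_{x,n}\}$ the set of arrival times of $P_x$, the value $\sigma_t(x)$ is allowed to change only at times $t\in\Upsilon_x$. (ii) For any $(x,y)\in\mathbb{Z}^2\times\mathbb{Z}^2$ the probability $\mathbb{P}(\{x,y\}\in E)$ is defined and can depend on $d(x,y)$; moreover, for distinct pairs $\{x,y\}\ne\{v,w\}$, the events $\{x,y\}\in E$ and $\{v,w\}\in E$ are mutually independent. (iii) The evolution is local: $\sigma_{t_{x,n}}(x)$ is measurable with respect to $\mathfrak{F}^x_{t_{x,n}}$, where $\mathfrak{F}^x_t$ denotes the $\sigma$-algebra generated by $\{\sigma_s(y): \{x,y\}\in E \text{ or } y=x,\ s<t\}$. (iv) Both the probability of two agents being linked and the evolution of $\sigma$ are translation invariant, i.e. for all $x,y,v\in\mathbb{Z}^2$, $\mathbb{P}(\{x,y\}\in E)=\mathbb{P}(\{x+v,y+v\}\in E)$ and $\mathbb{P}(\sigma_t\in A\mid\sigma_0=\eta)=\mathbb{P}(\sigma_t\in A+v\mid\sigma_0(\cdot)=\eta(\cdot+v))$, where $A+v=\{\xi(\cdot+v):\xi\in A\}$. Then $\sigma$ satisfies the spatial mixing property: for any finite region $\Lambda_0\subset\mathbb{Z}^2$, any $\eta\in\{-1,+1\}^{\Lambda_0}$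 and any $t\ge 0$, $$\lim_{\Lambda\to\mathbb{Z}^2}\mathbb{P}\big(\sigma_{\Lambda_0}(t)=\eta\,\big|\,\mathcal{F}^{\Lambda^c}_t\big)=\mathbb{P}\big(\sigma_{\Lambda_0}(t)=\eta\big)\qquad\text{almost surely},$$ where the limit is along increasing sequences of finite sets $\Lambda$ exhausting $\mathbb{Z}^2$ and, for $W\subseteq\mathbb{Z}^2$, $\mathcal{F}^W_t$ is the $\sigma$-algebra generated by $\bigcup_{x\in W}\mathfrak{F}^x_t$.
   Context: $\mathbb{Z}^2$ carries the distance $d(x,y)=|x_1-y_1|+|x_2-y_2|$. $\mathcal{G}=(V,E)$ is a random graph with vertex set $V=\mathbb{Z}^2$; edges exist with probability one between all $x,y$ with $d(x,y)=1$, and there is a constant $C>0$ such that $$\mathbb{P}(\{x,y\}\in E)\le \frac{C}{d(x,y)^9}\qquad\text{for all } x,y \text{ with } d(x,y)>1 .$$ Two agents (sites) $x,y$ are linked if $\{x,y\}\in E$. $\sigma:[0,\infty)\to S=\{-1,+1\}^{\mathbb{Z}^2}$ is a (not necessarily Markovian) stochastic process whose initial configuration $\sigma_0$ has the symmetric Bernoulli product law. The Poisson processes $P_x$ have rate 1 and are independent of the initial configuration and of the graph; at each arrival time $t_{x,n}$ of $P_x$ the agent $x$ updates his value to $\sigma_{t_{x,n}}(x)\in\{-1,+1\}$. The process is built by a graphical construction (basic coupling), so that versions of the process for all initial configurations are defined on the same probability space. For $\Lambda\subseteq\mathbb{Z}^2$, $\sigma_\Lambda(t)$ denotes the restriction of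 $\sigma_t$ to $\Lambda$ and $\Lambda^c=\mathbb{Z}^2\setminus\Lambda$.
   Formalization: The formal statement also assumes that the initial configuration is independent of the graph (and of all data driving the graphical construction); the context states only that the Poisson processes are independent of both, and without this assumption the claim can fail. *)

(* Defs.v *)
From HB Require Import structures.
From mathcomp Require Import all_boot all_order all_algebra finmap.
From mathcomp Require Import all_classical all_reals all_analysis.
Import Order.TTheory GRing.Theory Num.Theory.
Import numFieldNormedType.Exports.

Set Implicit Arguments.
Unset Strict Implicit.
Unset Printing Implicit Defensive.

Local Open Scope classical_set_scope.
Local Open Scope ring_scope.

Notation site := (int * int)%type.

Definition dist (x y : site) : nat := (`|x.1 - y.1| + `|x.2 - y.2|)%N.

(* The spin value [true] stands for +1 and [false] for -1. *)
Notation conf := (site -> bool).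

Definition conf_shift (v : site) (xi : conf) : conf := fun x => xi (x + v).

Definition conf_algebra : set (set conf) :=
  <<s [set B | exists x, B = [set xi : conf | xi x]] >>.

Section Probability.
Context {d : measure_display} {T : measurableType d} {R : realType}.
Variable P : probability T R.

Definition independent_events (I : eqType) (A : I -> set T) :=
  forall s : seq I, uniq s ->
    P (\bigcap_(i in [set` s]) A i) = (\prod_(i <- s) P (A i))%E.

Definition independent_algebras (I : eqType) (F : I -> set (set T)) :=
  forall A : I -> set T, (forall i, F i (A i)) -> independent_events A.

Definition independent2 (F G : set (set T)) :=
  forall A B, F A -> G B -> P (A `&` B) = (P A * P B)%E.

(* [f] is a version of the conditional probability P(A | F). *)
Definition is_cond_probability (F : set (set T)) (A : set T) (f : T -> R) :=
  [/\ forall U : set R, measurable U -> F (f @^-1` U),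
      P.-integrable setT (EFin \o f) &
      forall B, F B -> (\int[P]_(w in B) (f w)%:E = P (A `&` B))%E].

(* The arrival times of a process are numbered from 0, so the first gap is the
   first arrival time itself. *)
Definition gap (t : nat -> T -> R) (n : nat) : T -> R :=
  fun w => if n is m.+1 then t n w - t m w else t 0%N w.

Definition poisson_process (rate : R) (t : nat -> T -> R) :=
  [/\ forall n, measurable_fun setT (t n),
      independent_algebras
        (fun n => preimage_set_system setT (gap t n) measurable) &
      forall n (U : set R), measurable U ->
        P (gap t n @^-1` U) = exponential_prob rate U].

Definition symmetric_bernoulli (sigma0 : T -> conf) :=
  [/\ forall x, measurable [set w | sigma0 w x],
      independent_events (fun x => [set w | sigma0 w x]) &
      forall x, P [set w | sigma0 w x] = (2^-1)%:E].

End Probability.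

Section Algebras.
Context {d : measure_display} {T : measurableType d} {R : realType}.

Definition init_algebra (sigma0 : T -> conf) : set (set T) :=
  <<s [set B | exists x, B = [set w | sigma0 w x]] >>.

(* A random graph is given by its random edge set [E w]; an undirected edge
   between x and y is the two-element set {x,y}. *)
Definition linked (E : T -> set {fset site}) (x y : site) : set T :=
  [set w | E w [fset x; y]%fset].

Definition graph_algebra (E : T -> set {fset site}) : set (set T) :=
  <<s [set B | exists e, B = [set w | E w e]] >>.

Definition clock_algebra (t : nat -> T -> R) : set (set T) :=
  <<s \bigcup_n preimage_set_system setT (t n) measurable >>.

(* The sigma-algebra F^x_tau generated by
     { sigma_s(y) : {x,y} in E or y = x, s < tau },
   where the index set is itself random, through E and possibly through tau:
   its generators are the events "(y,s) belongs to the index set and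
   sigma_s(y) = a". For a deterministic time t, take [tau := cst t]. *)
Definition local_past (E : T -> set {fset site}) (sigma : R -> T -> conf)
    (x : site) (tau : T -> R) : set (set T) :=
  <<s [set B | exists (y : site) (s : R) (a : bool), 0 <= s /\
         B = [set w | (linked E x y w \/ y = x) /\ s < tau w
                      /\ sigma s w y = a]] >>.

Definition region_past (E : T -> set {fset site}) (sigma : R -> T -> conf)
    (W : set site) (t : R) : set (set T) :=
  <<s \bigcup_(x in W) local_past E sigma x (cst t) >>.

(* Graphical construction (basic coupling): [X eta t w] is the configuration at
   time t of the version started from eta, driven by the random elements
   generating the sigma-algebra [H], which do not involve the initial
   configuration. Since X is jointly measurable in (eta, w), for an initial
   configuration sigma0 independent of H the law of [X eta t] is the
   conditional law of [X (sigma0 w) t w] given sigma0 = eta. *)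
Definition graphical_construction (H : set (set T))
    (X : conf -> R -> T -> conf) :=
  (forall eta w, X eta 0 w = eta) /\
  (forall (t : R) (x : site), 0 <= t ->
     <<s [set Q : set (conf * T) |
            exists A B, [/\ conf_algebra A, H B & Q = A `*` B]] >>
       [set p | X p.1 t p.2 x]).

End Algebras.

(* Main.v *)
Require Import Defs.
From HB Require Import structures.
From mathcomp Require Import all_boot all_order all_algebra finmap.
From mathcomp Require Import all_classical all_reals all_analysis.
From mathcomp Require Import measurable_realfun ring lra.
Import Order.TTheory GRing.Theory Num.Theory.
Import numFieldNormedType.Exports.
Set Implicit Arguments.
Unset Strict Implicit.
Unset Printing Implicit Defensive.
Local Open Scope classical_set_scope.
Local Open Scope ring_scope.


(** The conditional probabilities [f n] are taken along a decreasing sequence of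
    sigma-algebras, so a maximal inequality for reverse martingales reduces the
    theorem to a mixing estimate: [P (A & B) - P A * P B] is small, uniformly
    over the events [B] of the past of the complement of [L n].

    For the estimate, follow the influences on a spin backward in time: they run
    along chains of neighbouring sites with decreasing update times. Cut [0, t]
    into windows so short that a site is updated in a given window with a small
    probability [eps]. A chain without repeated sites uses independent edges and
    clocks, and a chain of length [k] has at most [2 ^ (j + k)] choices of
    windows, so that the chains issued from a site are dominated by a kernel of
    row and column sums at most 1/2, because [d^-9] is summable on the lattice.
    Hence, outside an event of small probability, the spins of [L0] are computed
    inside a finite set [V], while every spin observed from far away is computed
    inside the complement of [V]. The sources of randomness of these two regions
    are independent. *)

(** * Sigma-algebras *)

(** Influence has no deterministic range: in an arbitrarily short time a site may read a distant
    neighbour that has itself just been updated. The localisation therefore holds only on a good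
    event, which depends on both regions at once and need not belong to the sigma-algebra of either.
    For this reason spins are not shown to be locally measurable; they are compared with local
    events on the good event ([agree_on]), and independence is applied to the local substitutes.

    Keeping window indices instead of update times makes the order along a chain weak. This is what
    permits erasing loops, hence restricting to chains without repeated sites.

    Row sums control the chains issued from one site, which suffices for the finite set [L0]. The
    observed region is infinite and is handled by summing over all chains that end in a given site
    of [V], which needs column sums; edges are undirected, so the two sums agree.

    Windows cannot serve as induction parameter for computing a spin, since several updates may
    share a window. The induction is on the number of arrivals in the confining set. *)

Section SigmaAlgebra.
Context {T : Type}.
Implicit Types (S : set (set T)) (A B : set T).

Lemma sigma_algebra_setC S A : sigma_algebra setT S -> S A -> S (~` A).
Proof. by move=> [_ SC _] SA; rewrite -setTD; apply: SC. Qed.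

Lemma sigma_algebra_setT S : sigma_algebra setT S -> S setT.
Proof.
by move=> SS; rewrite -setC0; apply: sigma_algebra_setC => //; case: SS.
Qed.

Lemma sigma_algebra_setU S A B : sigma_algebra setT S -> S A -> S B ->
  S (A `|` B).
Proof.
move=> [S0 _ SU] SA SB; rewrite -bigcup2E.
by apply: SU => -[|[|n]].
Qed.

Lemma sigma_algebra_setI S A B : sigma_algebra setT S -> S A -> S B ->
  S (A `&` B).
Proof.
move=> SS SA SB; rewrite -[A `&` B]setCK setCI.
apply: sigma_algebra_setC => //.
by apply: sigma_algebra_setU => //; exact: sigma_algebra_setC.
Qed.

Lemma sigma_algebra_setD S A B : sigma_algebra setT S -> S A -> S B ->
  S (A `\` B).
Proof.
move=> SS SA SB; rewrite setDE; apply: sigma_algebra_setI => //.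
exact: sigma_algebra_setC.
Qed.

Lemma sigma_algebra_bigcupT (I : countType) S (F : I -> set T) :
  sigma_algebra setT S -> (forall i, S (F i)) -> S (\bigcup_i F i).
Proof.
move=> [S0 SC SU] SF.
pose G n := if @choice.unpickle I n is Some i then F i else set0.
suff -> : \bigcup_i F i = \bigcup_n G n.
  by apply: SU => n; rewrite /G; case: choice.unpickle.
rewrite eqEsubset; split=> w.
  by case=> i _ Fi; exists (choice.pickle i) => //; rewrite /G choice.pickleK.
by case=> n _; rewrite /G; case: choice.unpickle => // i Fi; exists i.
Qed.

Lemma sigma_algebra_bigcapT (I : countType) S (F : I -> set T) :
  sigma_algebra setT S -> (forall i, S (F i)) -> S (\bigcap_i F i).
Proof.
move=> SS SF; rewrite -[X in S X]setCK setC_bigcap.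
apply: sigma_algebra_setC => //; apply: sigma_algebra_bigcupT => // i.
exact: sigma_algebra_setC.
Qed.

Lemma sigma_algebra_exists (I : countType) S (Q : I -> T -> Prop) :
  sigma_algebra setT S -> (forall i, S [set w | Q i w]) ->
  S [set w | exists i, Q i w].
Proof.
move=> SS SQ; rewrite (_ : [set w | _] = \bigcup_i [set w | Q i w]).
  exact: sigma_algebra_bigcupT.
rewrite eqEsubset; split=> w /=; first by case=> i Qi; exists i.
by case=> i _ Qi; exists i.
Qed.

Lemma sigma_algebra_forall (I : countType) S (Q : I -> T -> Prop) :
  sigma_algebra setT S -> (forall i, S [set w | Q i w]) ->
  S [set w | forall i, Q i w].
Proof.
move=> SS SQ; rewrite (_ : [set w | _] = \bigcap_i [set w | Q i w]).
  exact: sigma_algebra_bigcapT.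
by rewrite eqEsubset; split=> w /= Qw i; [move=> _|]; exact: Qw.
Qed.

Lemma sigma_algebra_constant S (C : Prop) : sigma_algebra setT S ->
  S [set _ | C].
Proof.
move=> SS; have [c|nc] := pselect C.
  rewrite (_ : [set _ | C] = setT); first exact: sigma_algebra_setT.
  by apply/seteqP; split.
by rewrite (_ : [set _ | C] = set0); [case: SS|apply/seteqP; split].
Qed.

Lemma sigma_algebra_and S (C : Prop) A : sigma_algebra setT S ->
  (C -> S A) -> S [set w | C /\ A w].
Proof.
move=> SS SA; have [c|nc] := pselect C.
  apply: sigma_algebra_setI => //; last exact: SA.
  exact: sigma_algebra_constant.
rewrite (_ : [set w | _] = set0); first by case: SS.
by apply/seteqP; split=> w // [/nc].
Qed.

Lemma sigma_algebra_imply S (C : Prop) A : sigma_algebra setT S ->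
  (C -> S A) -> S [set w | C -> A w].
Proof.
move=> SS SA; have [c|nc] := pselect C.
  rewrite (_ : [set w | _] = A); first exact: SA.
  by apply/seteqP; split=> w /=; first by move=> /(_ c).
rewrite (_ : [set w | _] = setT); first exact: sigma_algebra_setT.
by apply/seteqP; split=> // w _ /nc.
Qed.

(* On [M] the sets of this system coincide with members of [S]; since it is a
   sigma-algebra, a whole generated sigma-algebra can be compared with [S] on
   [M] by inspecting its generators, and [M] itself need not be in [S]. *)
Definition agree_on M S : set (set T) :=
  [set A | exists2 B, S B & A `&` M = B `&` M].

Lemma sigma_algebra_agree_on M S : sigma_algebra setT S ->
  sigma_algebra setT (agree_on M S).
Proof.
move=> SS; split.
- by exists set0 => //; case: SS.
- move=> A [B SB AB]; exists (~` B); first exact: sigma_algebra_setC.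
  rewrite setTD eqEsubset; split=> w [nw Mw]; split=> // Xw; apply: nw.
    by have [] : (A `&` M) w by rewrite AB.
  by have [] : (B `&` M) w by rewrite -AB.
- move=> A SA.
  have /choice [B SB] n : exists B, S B /\ A n `&` M = B `&` M.
    by have [B ? ?] := SA n; exists B.
  exists (\bigcup_n B n); first by case: SS => _ _; apply=> n; case: (SB n).
  rewrite !setI_bigcupl; apply: eq_bigcupr => n _.
  by case: (SB n).
Qed.

Lemma agree_on_sub M M' S A : M `<=` M' -> agree_on M' S A -> agree_on M S A.
Proof.
move=> MM' [B SB AB]; exists B => //.
by rewrite -(setIidr MM') !setIA AB.
Qed.

End SigmaAlgebra.

(** * Independence *)

Section Independence.
Context {d : measure_display} {T : measurableType d} {R : realType}.
Variable P : probability T R.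
Implicit Types (G : set (set T)) (A B : set T).

Lemma generated_measurable G : G `<=` measurable -> <<s G >> `<=` measurable.
Proof. by move=> Gm; apply: smallest_sub => //;
  exact: sigma_algebra_measurable. Qed.

Lemma independent2_sym G1 G2 : independent2 P G1 G2 -> independent2 P G2 G1.
Proof. by move=> G12 A B GA GB; rewrite setIC muleC; exact: G12. Qed.

Lemma independent2_sub G1 G2 G1' G2' : G1' `<=` G1 -> G2' `<=` G2 ->
  independent2 P G1 G2 -> independent2 P G1' G2'.
Proof. by move=> s1 s2 G12 A B /s1 GA /s2 GB; exact: G12. Qed.

Lemma probability_fin_num A : measurable A -> P A \is a fin_num.
Proof. by move=> mA; exact: fin_num_measure. Qed.

Lemma probabilityU A B : measurable A -> measurable B -> A `&` B = set0 ->
  P (A `|` B) = (P A + P B)%E.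
Proof. by move=> mA mB AB; rewrite measureU. Qed.

Lemma probabilityD A B : measurable A -> measurable B ->
  P (A `\` B) = (P A - P (A `&` B))%E.
Proof.
by move=> mA mB; rewrite measureD // ltey_eq probability_fin_num.
Qed.

(** Dynkin's argument: for a fixed [B] the product rule passes to complements and to disjoint
    unions, and [G1] is a pi-system. *)
Lemma independent2_generated_l G1 G2 : setI_closed G1 ->
  G1 `<=` measurable -> G2 `<=` measurable ->
  independent2 P G1 G2 -> independent2 P <<s G1 >> G2.
Proof.
move=> G1I G1m G2m G12 A B sA GB.
have mB := G2m _ GB.
suff : <<s G1 >> `<=` [set A | measurable A /\ P (A `&` B) = (P A * P B)%E].
  by move=> /(_ _ sA) [].
apply: lambda_system_subset => //.
  apply/dynkin_lambda_system; split.
  - by split=> //; rewrite setTI probability_setT mul1e.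
  - move=> S [mS PS]; split; first exact: measurableC.
    have -> : ~` S `&` B = B `\` S by rewrite setDE setIC.
    transitivity (P B - P (S `&` B))%E.
      by rewrite setIC probabilityD.
    rewrite PS probability_setC //.
    have := probability_fin_num mS; have := probability_fin_num mB.
    case: (P S) => // s; case: (P B) => // b _ _.
    by rewrite -EFinM -!EFinB -EFinM; congr EFin; ring.
  - move=> F tF FS; split; first by apply: bigcupT_measurable => n;
    case: (FS n).
    have mF n : measurable (F n) by case: (FS n).
    rewrite setI_bigcupl measure_bigcup //=; last first.
    - exact: trivIset_setIr.
    - by move=> i _; exact: measurableI.
    rewrite measure_bigcup //= muleC -(fineK (probability_fin_num mB)).
    rewrite -nneseriesZl; last by move=> *; exact: measure_ge0.
    rewrite fineK ?probability_fin_num //.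
    by apply: eq_eseriesr => n _; case: (FS n) => _ /= ->; rewrite muleC.
by move=> S GS; split; [exact: G1m|exact: G12].
Qed.

Lemma independent2_generated G1 G2 : setI_closed G1 -> setI_closed G2 ->
  G1 `<=` measurable -> G2 `<=` measurable ->
  independent2 P G1 G2 -> independent2 P <<s G1 >> <<s G2 >>.
Proof.
move=> G1I G2I G1m G2m G12; apply: independent2_generated_l => //.
  exact: generated_measurable.
apply: independent2_sym; apply: independent2_generated_l => //.
exact: independent2_sym.
Qed.

Section Grouping.
Context {I : eqType}.
Variable F : I -> set (set T).
Hypotheses (F_measurable : forall i, F i `<=` measurable)
  (F_setI : forall i, setI_closed (F i)) (F_setT : forall i, F i setT)
  (F_indep : independent_algebras P F).

(** The sets [A i] with [i] off [s] are also kept in [F i], because [independent_algebras] speaks of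
    total families. *)
Let cylinders (J : set I) : set (set T) :=
  [set B | exists (s : seq I) (A : I -> set T), [/\ uniq s, [set` s] `<=` J,
    forall i, F i (A i) &
    B = \bigcap_(i in [set` s]) A i]].

Let cylinders_setI J : setI_closed (cylinders J).
Proof.
move=> _ _ [s1 [A1 [u1 J1 F1 ->]]] [s2 [A2 [u2 J2 F2 ->]]].
exists (undup (s1 ++ s2)), (fun i => (if i \in s1 then A1 i else setT) `&`
  (if i \in s2 then A2 i else setT)).
split.
- exact: undup_uniq.
- move=> i /=; rewrite mem_undup mem_cat => /orP[/J1|/J2] //.
- by move=> i; apply: F_setI; case: ifP.
- rewrite eqEsubset; split=> w.
    move=> [w1 w2] i /= _; split; case: ifP => // si; [exact: w1|exact: w2].
  move=> ws; split=> i /= si.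
    have /ws [] : [set` undup (s1 ++ s2)] i.
      by rewrite /= mem_undup mem_cat si.
    by rewrite si.
  have /ws [] : [set` undup (s1 ++ s2)] i.
    by rewrite /= mem_undup mem_cat si orbT.
  by rewrite si.
Qed.

Let cylinders_measurable J : cylinders J `<=` measurable.
Proof.
move=> _ [s [A [_ _ FA ->]]]; apply: fin_bigcap_measurable => [|i _].
  exact: finite_seq.
exact: F_measurable.
Qed.

(** Cylinders over disjoint index sets concatenate to one cylinder, so [F_indep] gives the product
    rule on two generating pi-systems. *)
Lemma independent_grouping (J1 J2 : set I) : J1 `&` J2 = set0 ->
  independent2 P <<s \bigcup_(i in J1) F i >> <<s \bigcup_(i in J2) F i >>.
Proof.
move=> J12.
have sub J : <<s \bigcup_(i in J) F i >> `<=` <<s cylinders J >>.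
  apply: sub_sigma_algebra2 => B [i Ji FB].
  exists [:: i], (fun j => if j == i then B else setT); split=> //.
  - by move=> j /=; rewrite inE => /eqP ->.
  - by move=> j; case: eqP => // ->.
  - rewrite eqEsubset; split=> w; first by move=> Bw j /=; rewrite inE => ->.
    by move=> /(_ i); rewrite /= eqxx; apply; rewrite inE.
apply: (independent2_sub (@sub J1) (@sub J2)).
apply: independent2_generated => //.
move=> _ _ [s1 [A1 [u1 sJ1 F1 ->]]] [s2 [A2 [u2 sJ2 F2 ->]]].
have dis i : i \in s1 -> i \notin s2.
  move=> i1; apply/negP => i2.
  by have : (J1 `&` J2) i; [split; [exact: sJ1|exact: sJ2]|rewrite J12].
pose A i := if i \in s1 then A1 i else A2 i.
have A2E i : i \in s2 -> A i = A2 i.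
  by move=> i2; rewrite /A; case: ifP => // /dis; rewrite i2.
have FA i : F i (A i) by rewrite /A; case: ifP.
have u : uniq (s1 ++ s2).
  rewrite cat_uniq u1 u2 andbT /=; apply/hasPn => i i2; apply/negP => /dis.
  by rewrite i2.
have := F_indep FA u; rewrite big_cat /=.
have -> : \bigcap_(i in [set` s1 ++ s2]) A i =
    \bigcap_(i in [set` s1]) A1 i `&` \bigcap_(i in [set` s2]) A2 i.
  rewrite eqEsubset; split=> w.
    move=> ws; split=> i /= si.
      by have := ws i; rewrite /A /= mem_cat si; apply.
    by rewrite -A2E //; apply: ws; rewrite /= mem_cat si orbT.
  move=> [w1 w2] i /=; rewrite mem_cat => /orP[i1|i2].
    by rewrite /A i1; exact: w1.
  by rewrite A2E //; exact: w2.
move=> ->; rewrite (F_indep F1 u1) (F_indep F2 u2); congr (_ * _)%E.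
  by apply: eq_big_seq => i i1; rewrite /A i1.
by apply: eq_big_seq => i /A2E ->.
Qed.

End Grouping.

(** Adjoining [setT] to each event gives families of the kind that [independent_grouping] accepts:
    pi-systems containing the whole space. *)
Lemma independent_events_algebras (I : eqType) (A : I -> set T) :
  independent_events P A ->
  independent_algebras P (fun i => [set A i; setT]).
Proof.
move=> Aind B BA s us.
pose r := [seq i <- s | B i != setT].
have -> : \bigcap_(i in [set` s]) B i = \bigcap_(i in [set` r]) A i.
  rewrite eqEsubset; split=> w ws i /=.
    rewrite mem_filter => /andP[BT si].
    by have := ws _ si; case: (BA i) BT => -> //; rewrite eqxx.
  move=> si; have [->//|BT] := eqVneq (B i) setT.
  have := ws i; rewrite /= mem_filter BT si => /(_ isT).
  by case: (BA i) BT => -> //; rewrite eqxx.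
rewrite Aind ?filter_uniq // big_filter big_mkcond /=; apply: eq_bigr => i _.
case: (BA i) => ->; last by rewrite eqxx probability_setT.
by case: eqVneq => //= ->; rewrite probability_setT.
Qed.

End Independence.

(** * Exponential law *)

Section JointLaw.
Context {d : measure_display} {T : measurableType d} {R : realType}.
Variable P : probability T R.

(** Lets an event on two independent variables be computed by integrating over sections. *)
Lemma joint_law_product (X Y : {RV P >-> R}) (D : set (R * R)) :
  independent2 P (preimage_set_system setT X measurable)
    (preimage_set_system setT Y measurable) ->
  measurable D ->
  P [set w | D (X w, Y w)] = (distribution P X \x distribution P Y)%E D.
Proof.
move=> XY mD.
have mXY : measurable_fun setT (fun w => (X w, Y w)).
  by apply: measurable_fun_pair => //; exact: measurable_funPT.
pose Z : {mfun T >-> (R * R)%type} :=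
  HB.pack_for {mfun T >-> (R * R)%type} (fun w => (X w, Y w))
    (isMeasurableFun.Build _ _ _ _ _ mXY).
have ZE A B : P (Z @^-1` (A `*` B)) = P (X @^-1` A `&` Y @^-1` B) by [].
rewrite (@product_measure_unique _ _ _ _ _ _ _ (distribution P Z)) //.
move=> A B mA mB; rewrite /distribution /pushforward.
transitivity (P (X @^-1` A `&` Y @^-1` B)); first by [].
rewrite XY //.
- by exists A => //; rewrite setTI.
- by exists B => //; rewrite setTI.
Qed.

End JointLaw.

Section ExponentialLaw.
Context {d : measure_display} {T : measurableType d} {R : realType}.
Variables (P : probability T R) (X : T -> R).
Hypotheses (mX : measurable_fun setT X)
  (X_exp : forall U : set R,
    measurable U -> P (X @^-1` U) = exponential_prob 1 U).

Let mXU U : measurable U -> measurable (X @^-1` U).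
Proof. by move=> mU; rewrite -[_ @^-1` _]setTI; exact: mX. Qed.

Lemma exponential_itv0c (u : R) : 0 < u ->
  P [set w | 0 <= X w <= u] = (1 - expR (- u))%:E.
Proof.
move=> u0; have -> : [set w | 0 <= X w <= u] = X @^-1` `[0, u].
  by apply/seteqP; split=> w /=; rewrite in_itv.
by rewrite X_exp // exponential_prob_itv0c // mulN1r.
Qed.

Lemma exponential_lt0 : P [set w | X w < 0] = 0%E.
Proof.
have -> : [set w | X w < 0] = X @^-1` `]-oo, 0[.
  by apply/seteqP; split=> w /=; rewrite in_itv.
rewrite X_exp // /exponential_prob integral0_eq // => x /=.
by rewrite in_itv /= => /lt0_exponential_pdf ->.
Qed.

Lemma exponential_le (u : R) : 0 < u ->
  P [set w | X w <= u] = (1 - expR (- u))%:E.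
Proof.
move=> u0; have -> : [set w | X w <= u] =
    [set w | X w < 0] `|` [set w | 0 <= X w <= u].
  apply/seteqP; split=> w /=.
    by case: (ltP (X w) 0) => [|_ ->]; [left|right].
  by case=> [/ltW/le_trans->//|/andP[]//]; exact: ltW.
have m1 : measurable [set w | X w < 0].
  have -> : [set w | X w < 0] = X @^-1` `]-oo, 0[.
    by apply/seteqP; split=> w /=; rewrite in_itv.
  exact: mXU.
have m2 : measurable [set w | 0 <= X w <= u].
  have -> : [set w | 0 <= X w <= u] = X @^-1` `[0, u].
    by apply/seteqP; split=> w /=; rewrite in_itv.
  exact: mXU.
rewrite probabilityU // ?exponential_lt0 ?add0e ?exponential_itv0c //.
by apply/seteqP; split=> w //= [+ /andP[]]; rewrite ltNge => /negP.
Qed.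

Lemma exponential_le0 : P [set w | X w <= 0] = 0%E.
Proof.
apply/eqP; rewrite eq_le measure_ge0 andbT; apply/lee_addgt0Pr => e e0.
rewrite add0e.
have mle (u : R) : measurable [set w | X w <= u].
  have -> : [set w | X w <= u] = X @^-1` `]-oo, u].
    by apply/seteqP; split=> w /=; rewrite in_itv.
  exact: mXU.
apply: (@le_trans _ _ (P [set w | X w <= e])).
  by apply: le_measure; rewrite ?inE // => w /= /le_trans; apply; exact: ltW.
rewrite exponential_le // lee_fin lerBlDr.
by have := expR_ge1Dx (- e); lra.
Qed.

Lemma exponential_gt (u : R) : 0 <= u ->
  P [set w | u < X w] = (expR (- u))%:E.
Proof.
move=> u0; have -> : [set w | u < X w] = ~` [set w | X w <= u].
  by apply/seteqP; split=> w /=; rewrite ltNge => /negP.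
rewrite probability_setC; last first.
  have -> : [set w | X w <= u] = X @^-1` `]-oo, u].
    by apply/seteqP; split=> w /=; rewrite in_itv.
  exact: mXU.
move: u0; rewrite le_eqVlt => /predU1P[<-|u0].
  by rewrite exponential_le0 sube0 oppr0 expR0.
by rewrite exponential_le // -EFinB; congr EFin; ring.
Qed.

Lemma exponential_itvoc (u v : R) : 0 <= u -> u <= v ->
  P [set w | u < X w <= v] = (expR (- u) - expR (- v))%:E.
Proof.
move=> u0 uv.
have mgt (r : R) : measurable [set w | r < X w].
  have -> : [set w | r < X w] = X @^-1` `]r, +oo[.
    by apply/seteqP; split=> w /=; rewrite in_itv /= andbT.
  exact: mXU.
have -> : [set w | u < X w <= v] = [set w | u < X w] `\` [set w | v < X w].
  apply/seteqP; split=> w /=; first by move=> /andP[-> wv]; split=> //;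
    rewrite ltNge wv.
  by move=> [-> /negP]; rewrite -leNgt.
rewrite probabilityD //.
rewrite [X in (_ - P X)%E](_ : _ = [set w | v < X w]); last first.
  by apply/seteqP; split=> w /= => [[]//|vw]; split=> //; exact: le_lt_trans vw.
by rewrite !exponential_gt // (le_trans u0).
Qed.

End ExponentialLaw.

(** * Poisson arrivals *)

Lemma measurable_set_le {d : measure_display} {T : measurableType d}
    {R : realType} (f g : T -> R) :
  measurable_fun setT f -> measurable_fun setT g ->
  measurable [set x | f x <= g x].
Proof.
move=> mf mg; have := measurable_fun_ler mf mg.
by move=> /(_ measurableT [set true]); rewrite setTI; exact.
Qed.

Lemma measurable_set_lt {d : measure_display} {T : measurableType d}
    {R : realType} (f g : T -> R) :
  measurable_fun setT f -> measurable_fun setT g ->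
  measurable [set x | f x < g x].
Proof.
move=> mf mg; have := measurable_fun_ltr mf mg.
by move=> /(_ measurableT [set true]); rewrite setTI; exact.
Qed.

Section PoissonArrivals.
Context {d : measure_display} {T : measurableType d} {R : realType}.
Variables (P : probability T R) (t : nat -> T -> R).
Hypothesis t_poisson : poisson_process P 1 t.

Let mt n : measurable_fun setT (t n). Proof. by case: t_poisson. Qed.

(** The value 0 before the first arrival matches [gap], so that [gap t n] is [t n - previous n] for
    every [n]. *)
Let previous n : T -> R := fun w => if n is m.+1 then t m w else 0.

Let gapE n w : gap t n w = t n w - previous n w.
Proof. by case: n => [|n] //=; rewrite subr0. Qed.

Let mprevious n : measurable_fun setT (previous n).
Proof.
by case: n => [|n]; [exact: (measurable_cst (0 : R))|exact: (mt n)].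
Qed.


Let mgap n : measurable_fun setT (gap t n).
Proof.
rewrite (_ : gap t n = t n \- previous n); first exact: measurable_funB.
by apply/funext => w; exact: gapE.
Qed.

Let gap_exp n U : measurable U -> P (gap t n @^-1` U) = exponential_prob 1 U.
Proof. by case: t_poisson => _ _; exact. Qed.

Let gap_algebra n : set (set T) :=
  preimage_set_system setT (gap t n) measurable.

Let gap_algebraT n : gap_algebra n setT.
Proof. by exists setT => //; rewrite setTI preimage_setT. Qed.

Let gap_algebraI n : setI_closed (gap_algebra n).
Proof.
move=> _ _ [A mA <-] [B mB <-]; exists (A `&` B); first by apply: measurableI.
by rewrite !setTI preimage_setI.
Qed.

Let gap_algebra_measurable n : gap_algebra n `<=` measurable.
Proof. by move=> _ [A mA <-]; exact: mgap. Qed.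

Let previous_generated n U : measurable U ->
  <<s \bigcup_(i in [set i | (i < n)%N]) gap_algebra i >> (previous n @^-1` U).
Proof.
set G := \bigcup_(i in _) _ => mU.
have mG i : (i < n)%N ->
    measurable_fun (setT : set (g_sigma_algebraType G)) (gap t i).
  move=> ltin _ V mV; apply: sub_sigma_algebra; exists i => //.
  by exists V.
suff : measurable_fun (setT : set (g_sigma_algebraType G)) (previous n).
  by move=> /(_ measurableT _ mU); rewrite setTI.
have : (n <= n)%N by [].
elim: {-2}n => [|m IH] ltmn; first exact: (measurable_cst (0 : R)).
rewrite (_ : previous m.+1 = (previous m \+ gap t m)); last first.
  by apply/funext => w /=; rewrite gapE addrC subrK.
by apply: measurable_funD; [exact: (IH (ltnW ltmn))|exact: mG].
Qed.

Let previous_gap_independent n :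
  independent2 P (preimage_set_system setT (previous n) measurable)
    (preimage_set_system setT (gap t n) measurable).
Proof.
case: t_poisson => _ gap_indep _.
have := @independent_grouping _ _ _ P nat gap_algebra gap_algebra_measurable
  gap_algebraI gap_algebraT gap_indep [set i | (i < n)%N] [set n].
have disj : [set i | (i < n)%N] `&` [set n] = set0.
  apply/seteqP; split=> [i [] /= lt_in e|i []//].
  by rewrite e ltnn in lt_in.
move=> /(_ disj); apply: independent2_sub.
  by move=> _ [U mU <-]; rewrite setTI; exact: previous_generated.
by move=> A gA; apply: sub_sigma_algebra; exists n.
Qed.

(** Absence of memory: once [previous n = s <= a] is fixed, the event says that the independent gap
    lies between [a - s] and [a - s + dl], and its exponential law splits off the factor
    [1 - expR (- dl)] from the event that the gap exceeds [a - s]. *)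
Let interarrival n (a dl : R) : 0 <= a -> 0 <= dl ->
  P [set w | previous n w <= a /\ a < t n w <= a + dl] =
  ((1 - expR (- dl))%:E * P [set w | (previous n w <= a < t n w)%R])%E.
Proof.
move=> a0 dl0.
pose X : {mfun T >-> R} := HB.pack_for {mfun T >-> R} (previous n)
  (isMeasurableFun.Build _ _ _ _ _ (@mprevious n)).
pose Y : {mfun T >-> R} := HB.pack_for {mfun T >-> R} (gap t n)
  (isMeasurableFun.Build _ _ _ _ _ (@mgap n)).
pose D2 := [set z : R * R | z.1 <= a] `&` [set z | a < z.1 + z.2].
pose D1 := D2 `&` [set z : R * R | z.1 + z.2 <= a + dl].
have mD : measurable_fun setT (fun z : R * R => z.1 + z.2).
  by apply: measurable_funD; [exact: measurable_fst|exact: measurable_snd].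
have mD2 : measurable D2.
  apply: measurableI; first by apply: measurable_set_le;
    [exact: measurable_fst|exact: measurable_cst].
  by apply: measurable_set_lt => //; exact: measurable_cst.
have mD1 : measurable D1.
  apply: measurableI => //.
  by apply: measurable_set_le => //; exact: measurable_cst.
have XYE w : previous n w + gap t n w = t n w by rewrite gapE addrC subrK.
have XY : independent2 P (preimage_set_system setT X measurable)
    (preimage_set_system setT Y measurable) := @previous_gap_independent n.
have -> : [set w | previous n w <= a /\ a < t n w <= a + dl] =
    [set w | D1 (X w, Y w)].
  apply/seteqP; split=> w; rewrite /D1 /D2 /= XYE.
    by move=> [? /andP[]].
  by move=> [[-> ->] ->].
have -> : [set w | previous n w <= a < t n w] = [set w | D2 (X w, Y w)].
  apply/seteqP; split=> w; rewrite /D2 /= XYE.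
    by move=> /andP[].
  by move=> [-> ->].
rewrite (joint_law_product XY mD1) (joint_law_product XY mD2).
rewrite /product_measure1 -ge0_integralZl //=; last 2 first.
- exact: measurable_fun_xsection.
- by rewrite lee_fin subr_ge0 -expR0 ler_expR oppr_le0.
apply: eq_integral => s _ /=.
rewrite /distribution /pushforward.
have [sa|sa] := leP s a; last first.
  rewrite [X in P X](_ : _ = set0); last first.
    by apply/seteqP; split=> w //=; rewrite /xsection /= inE => -[[/=]];
      rewrite leNgt sa.
  rewrite [X in (_ * P X)%E](_ : _ = set0); last first.
    by apply/seteqP; split=> w //=; rewrite /xsection /= inE => -[/=];
      rewrite leNgt sa.
  by rewrite measure0 mule0.
have sa0 : 0 <= a - s by rewrite subr_ge0.
rewrite [X in P X](_ : _ = [set w | a - s < gap t n w <= a - s + dl]);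
  last first.
  apply/seteqP; split=> w /=; rewrite /xsection /= inE /D1 /D2 /=.
    by move=> [[_ ?] ?]; apply/andP; split; lra.
  by move=> /andP[? ?]; split; [split=> //|]; lra.
rewrite [X in (_ * P X)%E](_ : _ = [set w | a - s < gap t n w]); last first.
  apply/seteqP; split=> w /=; rewrite /xsection /= inE /D2 /=.
    by move=> [_ ?]; lra.
  by move=> ?; split=> //; lra.
rewrite (exponential_itvoc (@mgap n) (@gap_exp n)) // ?lerDl //.
rewrite (exponential_gt (@mgap n) (@gap_exp n)) //.
rewrite -EFinM; congr EFin.
by rewrite (_ : - (a - s + dl) = - (a - s) + - dl) ?expRD; ring.
Qed.

(** The numbering of the arrivals is increasing only almost surely; arguments about order are
    carried out on this event. *)
Let positive_gaps : set T := [set w | forall n, 0 < gap t n w].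

Let positive_gaps_measurable : measurable positive_gaps.
Proof.
apply: (sigma_algebra_forall (sigma_algebra_measurable T)) => n.
by apply: measurable_set_lt => //; exact: measurable_cst.
Qed.

Let positive_gapsC : P (~` positive_gaps) = 0%E.
Proof.
apply/eqP; rewrite eq_le measure_ge0 andbT.
pose N n := [set w | gap t n w <= 0].
have mN n : measurable (N n) by apply: measurable_set_le => //;
  exact: measurable_cst.
apply: (le_trans (measure_sigma_subadditive P mN _ _)).
- exact: measurableC.
- move=> w /= /existsNP[n /negP]; rewrite -leNgt => ?.
  by exists n.
- by rewrite eseries0 // => n _ _;
  exact: (exponential_le0 (@mgap n) (@gap_exp n)).
Qed.

Let arrivals_mono w : positive_gaps w -> forall m n,
  (m <= n)%N -> t m w <= t n w.
Proof.
move=> pos m n /subnK <-; elim: (n - m)%N => [|k IH] //.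
rewrite addSn (le_trans IH) //; have := pos (k + m).+1.
by rewrite /= subr_gt0 => /ltW.
Qed.

Let P_positive_gaps A : measurable A -> P A = P (A `&` positive_gaps).
Proof.
move=> mA; rewrite -[in LHS](setUIDK A positive_gaps) probabilityU.
- have -> : P (A `\` positive_gaps) = 0%E; last by rewrite adde0.
  apply: (subset_measure0 _ _ _ positive_gapsC) => //.
  + by apply: measurableD.
  + by apply: measurableC.
- by apply: measurableI.
- by apply: measurableD.
- by apply/seteqP; split=> w //= [[_ ?] []].
Qed.

(** The arrivals number [n - 1] and [n] enclose [a] for at most one [n]. The events [V n] are thus
    almost surely disjoint, with total probability at most 1, and [interarrival] multiplies each by
    [1 - expR (- dl)]. *)
Lemma poisson_arrival_window (a dl : R) : 0 <= a -> 0 <= dl ->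
  (P [set w | exists n, (a < t n w <= a + dl)%R] <= (1 - expR (- dl))%:E)%E.
Proof.
move=> a0 dl0.
pose V n := [set w | previous n w <= a < t n w].
pose W n := [set w | previous n w <= a /\ a < t n w <= a + dl].
have mV n : measurable (V n).
  rewrite (_ : V n = [set w | previous n w <= a] `&` [set w | a < t n w]).
    by apply: measurableI; [exact: measurable_set_le|exact: measurable_set_lt].
  by apply/seteqP; split=> w; rewrite /V /=; [move=> /andP[]|move=> [-> ->]].
have mW n : measurable (W n).
  rewrite (_ : W n = V n `&` [set w | t n w <= a + dl]).
    by apply: measurableI => //; exact: measurable_set_le.
  apply/seteqP; split=> w; rewrite /V /W /=; first by move=> [-> /andP[-> ->]].
  by move=> [/andP[-> ->] ->].
have mE : measurable [set w | exists n, a < t n w <= a + dl].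
  apply: (sigma_algebra_exists (sigma_algebra_measurable T)) => n.
  rewrite (_ : [set w | _] = [set w | a < t n w] `&` [set w | t n w <= a + dl]).
    by apply: measurableI; [exact: measurable_set_lt|exact: measurable_set_le].
  by apply/seteqP; split=> w /= => [/andP[]|[-> ->]].
rewrite P_positive_gaps //.
apply: (@le_trans _ _ (\sum_(0 <= n <oo) P (W n))%E).
  apply: measure_sigma_subadditive => //; first by apply: measurableI.
  move=> w [/= [m /andP[am ma]] pos].
  have ex : exists n, a < t n w by exists m.
  (* The first arrival after [a] also falls in the window, and its predecessor is at most [a]. *)
  have lem : (ex_minn ex <= m)%N by case: ex_minnP => n _; apply.
  exists (ex_minn ex) => //; rewrite /W /=; case: ex_minnP lem => n an minn lem.
  rewrite an (le_trans (arrivals_mono pos lem)) //; split=> //.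
  case: n an minn lem => [|n] // _ minn _; rewrite leNgt; apply/negP => /minn.
  by rewrite ltnn.
rewrite (eq_eseriesr (fun n _ => interarrival n a0 dl0)).
rewrite nneseriesZl; last by move=> *; exact: measure_ge0.
rewrite -[leRHS]mule1; apply: lee_wpmul2l.
  by rewrite lee_fin subr_ge0 -expR0 ler_expR oppr_le0.
rewrite (eq_eseriesr (fun n _ => P_positive_gaps (mV n))).
rewrite [leLHS](_ : _ = P (\bigcup_n (V n `&` positive_gaps))).
  apply: probability_le1; apply: bigcupT_measurable => n.
  by apply: measurableI.
rewrite measure_bigcup //=.
- by apply: eq_eseriesl => n; rewrite in_setT.
- by move=> n _; apply: measurableI.
- move=> i j _ _ [w [[/= /andP[i1 i2] pos] [/andP[j1 j2] _]]].
  have lt k l : previous k w <= a -> a < t l w -> (k <= l)%N.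
    case: k => // k /= ka al; rewrite ltnNge; apply/negP => lk.
    by have := le_lt_trans (le_trans (arrivals_mono pos lk) ka) al;
      rewrite ltxx.
  by apply/eqP; rewrite eqn_leq !lt.
Qed.

(** If all arrivals are at most [u], then so are the first [n] gaps; being independent, they satisfy
    this with probability [q ^+ n], where [q < 1]. *)
Lemma poisson_arrivals_unbounded (u : R) : 0 < u ->
  P [set w | forall n, t n w <= u] = 0%E.
Proof.
move=> u0.
have mE : measurable [set w | forall n, t n w <= u].
  apply: (sigma_algebra_forall (sigma_algebra_measurable T)) => n.
  by apply: measurable_set_le => //; exact: measurable_cst.
pose q : R := 1 - expR (- u).
have q0 : 0 <= q by rewrite subr_ge0 -expR0 ler_expR oppr_le0 ltW.
have q1 : q < 1 by rewrite ltrBlDr ltrDl expR_gt0.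
have bnd (n : nat) : (P [set w | forall n, (t n w <= u)%R] <= (q ^+ n)%:E)%E.
  pose B (i : nat) := [set w | gap t i w <= u].
  have gB i : gap_algebra i (B i).
    exists `]-oo, u]%classic => //; rewrite setTI.
    by apply/seteqP; split=> w; rewrite /B /= in_itv.
  have -> : (q ^+ n)%:E = P (\bigcap_(i in [set` iota 0 n]) B i).
    case: t_poisson => _ gap_indep _.
    rewrite (gap_indep B gB (iota 0 n) (iota_uniq 0 n)).
    rewrite (eq_bigr (fun=> q%:E)) => [|i _].
      by rewrite prodEFin big_const_seq count_predT size_iota iter_mulr_1.
    by rewrite (exponential_le (@mgap i) (@gap_exp i)).
  rewrite P_positive_gaps //; apply: le_measure; rewrite ?inE.
  - by apply: measurableI.
  - by apply: fin_bigcap_measurable => // i _;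
    exact: gap_algebra_measurable (gB i).
  - move=> w [/= tu pos] i _; rewrite /B /= gapE lerBlDr.
    rewrite (le_trans (tu i)) // lerDl.
    by case: i => //= i; rewrite (le_trans _ (arrivals_mono pos (leq0n i))) //
      ltW //; exact: (pos 0%N).
apply/eqP; rewrite eq_le measure_ge0 andbT.
have := probability_fin_num P mE; case: (P _) bnd => // p bnd _.
rewrite lee_fin; apply: (@cvgr_to_ge nat \oo _ R (fun n => q ^+ n) 0 p).
  by apply: cvg_expr; rewrite ger0_norm.
by apply: nearW => n; rewrite -lee_fin.
Qed.

Lemma poisson_arrivals_regular (u : R) : 0 < u ->
  P.-negligible [set w | ~ ((forall m n, (m <= n)%N -> t m w <= t n w) /\
                            exists n, u < t n w)].
Proof.
move=> u0; have mE : measurable [set w | forall n, t n w <= u].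
  apply: (sigma_algebra_forall (sigma_algebra_measurable T)) => n.
  by apply: measurable_set_le => //; exact: measurable_cst.
apply: (@negligibleS _ _ _ _ (~` positive_gaps `|` [set w | forall n,
  t n w <= u])).
  move=> w /= /not_andP[nm|nu].
    by left=> pos; apply: nm => m n; exact: arrivals_mono.
  by right=> n; rewrite leNgt; apply/negP => un; apply: nu; exists n.
apply: negligibleU; apply/negligibleP => //.
- by apply: measurableC.
- exact: poisson_arrivals_unbounded.
Qed.

End PoissonArrivals.

(** * Sums over paths *)

Section Sums.
Context {R : realType}.
Local Open Scope ereal_scope.

Lemma esum_mull_le (I : choiceType) (J : set I) (c : \bar R) (a : I -> \bar R) :
  0 <= c -> (forall i, 0 <= a i) ->
  \esum_(i in J) (c * a i) <= c * \esum_(i in J) a i.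
Proof.
move=> c0 a0; apply: ge_ereal_sup => _ [F [finF FJ] <-].
rewrite -ge0_mule_fsumr //; apply: lee_wpmul2l => //.
by apply: ereal_sup_ubound; exists F.
Qed.

(** Used with [I] a type of paths: all but finitely many paths have a small total weight. *)
Lemma esum_tail (I : choiceType) (J : set I) (a : I -> \bar R) (e : R) :
  (forall i, 0 <= a i) -> \esum_(i in J) a i < +oo -> (0 < e)%R ->
  exists2 F : set I, finite_set F & \esum_(i in J `\` F) a i <= e%:E.
Proof.
move=> a0 aoo e0.
have afin : \esum_(i in J) a i \is a fin_num.
  by rewrite ge0_fin_numE //; exact: esum_ge0.
have [_ [F [finF FJ] <-] lt_F] := ub_ereal_sup_adherent e0 afin.
exists F => //.
have := @esumID R I F J a (fun i _ => a0 i).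
rewrite (setIidr FJ) -setDE => Esum.
have F_fin : \esum_(i in F) a i \is a fin_num.
  rewrite ge0_fin_numE ?esum_ge0 //; apply: le_lt_trans aoo.
  by rewrite Esum leeDl // esum_ge0.
rewrite -esum_fset // in lt_F.
rewrite -(leeD2lE _ _ F_fin) -Esum.
by move: lt_F; rewrite lteBlDr // => /ltW.
Qed.

Lemma measure_bigcup_esum {d : measure_display} {T : measurableType d}
    (mu : {measure set T -> \bar R}) (I : countType) (J : set I)
    (B : I -> set T) (A : set T) : (forall i, measurable (B i)) ->
  measurable A -> A `<=` \bigcup_(i in J) B i ->
  mu A <= \esum_(i in J) mu (B i).
Proof.
move=> mB mA AB.
(* The family is laid out along the codes of [I]; codes outside the image of [J] carry the empty
   set. *)
pose G n := \bigcup_(i in J `&` [set i | choice.pickle i = n]) B i.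
have Gp i : J i -> G (choice.pickle i) = B i.
  move=> Ji; apply/seteqP; split=> w; last by exists i.
  case=> j [_ /= /(pcan_inj (@choice.pickleK I)) -> //].
have G0 n : ~ (choice.pickle @` J) n -> G n = set0.
  move=> nJ; apply/seteqP; split=> w // [i [Ji /= Ei] _].
  by apply: nJ; exists i.
have mG n : measurable (G n).
  have [[i Ji <-]|nJ] := pselect ((choice.pickle @` J) n); first by rewrite Gp.
  by rewrite G0.
apply: (@le_trans _ _ (\sum_(0 <= n <oo) mu (G n))).
  apply: measure_sigma_subadditive => // w /AB [i Ji Bi];
    exists (choice.pickle i) => //; rewrite Gp //.
rewrite nneseries_esumT; last by move=> n; exact: measure_ge0.
rewrite (_ : \esum_(n in setT) _ = \esum_(n in choice.pickle @` J) mu (G n));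
  last first.
  rewrite [RHS]esum_mkcond; apply: eq_esum => n _.
  case: ifPn => // /negP nJ; rewrite G0 ?measure0 // => Jn; apply: nJ.
  by rewrite inE.
rewrite (reindex_esum J _ choice.pickle).
  by apply: le_esum => i Ji; rewrite Gp.
split; first by move=> i Ji; exists i.
  by move=> i j _ _; exact: (pcan_inj (@choice.pickleK I)).
by [].
Qed.

Section PathWeight.
Context {S : choiceType}.
Variable q : S -> S -> R.
Hypotheses (q_ge0 : forall x y, (0 <= q x y)%R)
  (q_row : forall x, \esum_(y in [set: S]) (q x y)%:E <= (2^-1)%:E)
  (q_col : forall y, \esum_(x in [set: S]) (q x y)%:E <= (2^-1)%:E).

Fixpoint path_weight (x : S) (p : seq S) : R :=
  if p is y :: p' then (q x y * path_weight y p')%R else 1%R.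

Lemma path_weight_ge0 x p : (0 <= path_weight x p)%R.
Proof. by elim: p x => //= y p IH x; rewrite mulr_ge0. Qed.

Let halves : 2%:E * (2^-1)%:E = 1%:E :> \bar R.
Proof. by rewrite -EFinM divff. Qed.

Let two : 1%:E + 1%:E = 2%:E :> \bar R.
Proof. by rewrite -EFinD -mulr2n. Qed.

(** The bound 2 is the fixed point of [u = 1 + u / 2]: the empty path counts 1, and splitting off
    the first step costs a row sum. The induction bounds the length, which is harmless because a
    finite family of paths has bounded length. *)
Lemma esum_path_weight_from x :
  \esum_(p in [set: seq S]) (path_weight x p)%:E <= 2%:E.
Proof.
have sized k y : \esum_(p in [set p | (size p <= k)%N]) (path_weight y p)%:E <=
  2%:E.
  elim: k y => [|k IH] y.
    rewrite (_ : [set p | _] = [set [::]]); last first.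
      by apply/seteqP; split=> [[|//]|p /= ->].
    by rewrite esum_set1 // lee_fin ler1n.
  rewrite (esumID [set [::]]) => [|p _];
    last by rewrite lee_fin path_weight_ge0.
  rewrite -two; apply: leeD.
    rewrite (_ : _ `&` _ = [set [::]]) ?esum_set1 //.
    by apply/seteqP; split=> p /= [] // ->.
  rewrite (reindex_esum ([set: S] `*`` (fun=> [set p | (size p <= k)%N])) _
    (fun z => z.1 :: z.2)); last first.
    split.
    - by move=> [z p] [/= _ sp]; split.
    - by move=> [z p] [z' p'] _ _ /= [-> ->].
    - by move=> [|z p] [/= sp np] //; exists (z, p).
  rewrite -(@esum_esum _ _ _ setT (fun=> [set p | (size p <= k)%N])
     (fun z p => (path_weight y (z :: p))%:E)); last first.
    by move=> z p _ _; rewrite lee_fin (path_weight_ge0 y (z :: p)).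
  apply: (@le_trans _ _ (\esum_(z in setT) (2%:E * (q y z)%:E))).
    apply: le_esum => z _ /=; under eq_esum do rewrite EFinM.
    apply: le_trans (esum_mull_le _ _ _) _ => //.
    - by rewrite lee_fin.
    - by move=> p; rewrite lee_fin path_weight_ge0.
    - by rewrite muleC; apply: lee_wpmul2r; rewrite ?lee_fin.
  apply: le_trans (esum_mull_le _ _ _) _ => //; first by move=> z;
    rewrite lee_fin.
  by rewrite -halves; apply: lee_wpmul2l; rewrite ?lee_fin.
apply: ge_ereal_sup => _ [F [finF _] <-].
apply: le_trans (sized (\max_(p <- fset_set F) size p)%N x).
apply: esum_ge; exists F => //; split=> // p Fp /=.
apply: (@leq_bigmax_seq _ (enum_fset (fset_set F)) xpredT (@size S) p) => //.
by rewrite in_fset_set // inE.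
Qed.

(** The same recursion with a fixed endpoint: the first site is free and is summed out, which costs
    a column sum. *)
Lemma esum_path_weight_to y :
  \esum_(z in [set z : S * seq S | last z.1 z.2 = y]) (path_weight z.1 z.2)%:E
    <= 2%:E.
Proof.
pose A k := [set z : S * seq S | last z.1 z.2 = y /\ (size z.2 <= k)%N].
have sized k : \esum_(z in A k) (path_weight z.1 z.2)%:E <= 2%:E.
  elim: k => [|k IH].
    rewrite (_ : A 0%N = [set (y, [::])]); last first.
      by apply/seteqP; rewrite /A; split=> [[x [|z p]] [] //= ->|p ->].
    by rewrite esum_set1 // lee_fin ler1n.
  rewrite (esumID [set (y, [::])]) => [|p _];
    last by rewrite lee_fin path_weight_ge0.
  rewrite -two; apply: leeD.
    rewrite (_ : _ `&` _ = [set (y, [::])]) ?esum_set1 //.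
    by apply/seteqP; split=> p; rewrite /A /=; [case|move=> ->].
  rewrite (reindex_esum (A k `*`` (fun=> [set: S])) _
    (fun u => (u.2, u.1.1 :: u.1.2))); last first.
    split.
    - by move=> [[z p] x] [[/= ? ?] _]; split.
    - by move=> [[z p] x] [[z' p'] x'] _ _ /= [-> -> ->].
    - move=> [x [|z p]] [[/= lp sp] np]; first by case: np; rewrite lp.
      by exists ((z, p), x).
  rewrite -(@esum_esum _ _ _ (A k) (fun=> setT)
     (fun z x => (path_weight x (z.1 :: z.2))%:E)); last first.
    by move=> z p _ _; rewrite lee_fin (path_weight_ge0 p (z.1 :: z.2)).
  apply: (@le_trans _ _ (\esum_(z in A k) ((2^-1)%:E * (path_weight z.1
    z.2)%:E))).
    apply: le_esum => z _ /=; under eq_esum do rewrite mulrC EFinM.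
    apply: le_trans (esum_mull_le _ _ _) _ => //.
    - by rewrite lee_fin path_weight_ge0.
    - by move=> x; rewrite lee_fin.
    - by rewrite muleC; apply: lee_wpmul2r; rewrite ?lee_fin ?path_weight_ge0.
  apply: le_trans (esum_mull_le _ _ _) _ => //.
  - by move=> z; rewrite lee_fin path_weight_ge0.
  - by rewrite -halves [leRHS]muleC; apply: lee_wpmul2l;
    rewrite ?lee_fin ?invr_ge0.
apply: ge_ereal_sup => _ [F [finF FA] <-].
apply: le_trans (sized (\max_(z <- fset_set F) size z.2)%N).
apply: esum_ge; exists F => //; split=> // z Fz; split; first exact: FA.
apply: (@leq_bigmax_seq _ (enum_fset (fset_set F)) xpredT
  (fun z : S * seq S => size z.2) z) => //.
by rewrite in_fset_set // inE.
Qed.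

End PathWeight.

End Sums.

(** * Summability on the lattice *)

Section LatticeSum.
Context {R : realType}.

(** Telescoping terms of total sum 1, comparable to the inverse square of [n] but also defined at
    0. *)
Let g (n : nat) : R := (n.+1 * n.+2)%:R^-1.

Let g_ge0 n : 0 <= g n. Proof. by rewrite invr_ge0 ler0n. Qed.

Let sum_g n : \sum_(0 <= i < n) g i = 1 - n.+1%:R^-1.
Proof.
elim: n => [|n IH]; first by rewrite big_geq // invr1 subrr.
rewrite big_nat_recr //= IH /g natrM -[n.+2]addn1 -[n.+1]addn1 !natrD.
have n0 : 0 <= n%:R :> R by [].
by field; apply/andP; split; apply: lt0r_neq0; lra.
Qed.

Let esum_nat : (\esum_(n in [set: nat]) (g n)%:E <= 1%:E)%E.
Proof.
rewrite -nneseries_esumT; last by move=> n; rewrite lee_fin.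
apply: lime_le.
  by apply: is_cvg_nneseries => n _ _; rewrite lee_fin.
apply: nearW => n; rewrite sumEFin lee_fin sum_g gerBl invr_ge0 ler0n //.
Qed.

Let esum_int (a : int) : (\esum_(b in [set: int]) (g `|b - a|%N)%:E <= 2%:E)%E.
Proof.
have -> : (\esum_(b in [set: int]) (g `|b - a|%N)%:E =
    \esum_(b in [set: int]) (g `|b|%N)%:E)%E.
  rewrite [LHS](reindex_esum setT _ (fun b => b + a)); last first.
    split=> //; first by move=> b c _ _ /addIr.
    by move=> b _; exists (b - a) => //; rewrite subrK.
  by apply: eq_esum => b _; rewrite addrK.
rewrite (esumID [set b : int | 0 <= b]); last by move=> b _; rewrite lee_fin.
rewrite !setTI (_ : 2 = 1 + 1 :> R) // EFinD; apply: leeD.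
  rewrite (reindex_esum setT _ Posz) //.
  split=> //; first by move=> m n _ _ [].
  by move=> [n|//] _; exists n.
rewrite (reindex_esum setT _ Negz); last first.
  split=> //; first by move=> m n _ _ [].
  by move=> [n /(_ isT)//|n _]; exists n.
(* [Negz n] has absolute value [n + 1], and [g] decreases. *)
apply: le_trans esum_nat; apply: le_esum => n _; rewrite lee_fin /g /=.
by rewrite lef_pV2 ?posrE ?ltr0n // ler_nat leq_mul.
Qed.

Lemma esum_site_le (C : R) (p : site -> site -> R) (x : site) :
  (forall y, 0 <= p x y) -> p x x = 0 ->
  (forall y, dist x y = 1%N -> p x y <= 1) ->
  (forall y, (1 < dist x y)%N -> p x y <= C / (dist x y)%:R ^+ 9) ->
  (\esum_(y in [set: site]) (p x y)%:E <= (144 * Num.max 1 C)%:E)%E.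
Proof.
move=> p0 px p1 p2; set K := Num.max 1 C.
have K1 : 1 <= K by rewrite le_max lexx.
have CK : C <= K by rewrite le_max lexx orbT.
(* A product bound makes the double sum factor. Each coordinate difference [k] is at most the
   distance [m], so [(k + 1) * (k + 2) <= 6 * m ^ 2]: this gives 36 = 6 * 6 and uses
   [m ^ 4 <= m ^ 9]. The two sums over the integers contribute 2 each, whence 144 = 36 * 4. *)
have bnd y : p x y <= 36 * K * (g `|y.1 - x.1|%N * g `|y.2 - x.2|%N).
  have [d0|d0] := posnP (dist x y).
    have -> : y = x.
      move/eqP: d0; rewrite /dist addn_eq0 !absz_eq0 !subr_eq0 =>
        /andP[/eqP e1 /eqP e2].
      by rewrite [x]surjective_pairing [y]surjective_pairing e1 e2.
    by rewrite px !mulr_ge0 // (le_trans _ K1).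
  have [m mE] : exists m, m = dist x y by exists (dist x y).
  have m0 : (0 < m)%N by rewrite mE.
  have pK : p x y <= K / m%:R ^+ 9.
    have [m1|m1] := leqP m 1.
      have m1' : m = 1%N by apply/eqP; rewrite eqn_leq m1 m0.
      by rewrite m1' expr1n divr1 (le_trans (p1 y _)) // -mE m1'.
    rewrite (le_trans (p2 y _)) // -?mE // ler_wpM2r // invr_ge0 exprn_ge0 //.
  apply: (le_trans pK); rewrite [36 * K]mulrC -mulrA ler_wpM2l ?(le_trans _ K1)
    //.
  have mR : 1 <= m%:R :> R by rewrite ler1n.
  have le1 (k : nat) : (k <= m)%N -> (k.+1 * k.+2)%:R <= 6 * m%:R ^+ 2 :> R.
    move=> km; have kR : k%:R <= m%:R :> R by rewrite ler_nat.
    have k0 : 0 <= k%:R :> R by [].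
    by rewrite natrM -[k.+2]addn1 -[k.+1]addn1 !natrD; nra.
  have a1 : (`|y.1 - x.1| <= m)%N by rewrite mE /dist distnC leq_addr.
  have a2 : (`|y.2 - x.2| <= m)%N by rewrite mE /dist [X in (X <= _)%N]distnC
    leq_addl.
  have gpos (k : nat) : 0 < (k.+1 * k.+2)%:R :> R by rewrite ltr0n.
  rewrite /g -invfM.
  rewrite ler_pdivlMr ?mulr_gt0 // -ler_pdivlMl ?invr_gt0 ?exprn_gt0 ?ltr0n //
    invrK.
  apply: (@le_trans _ _ (6 * m%:R ^+ 2 * (6 * m%:R ^+ 2))).
    by apply: ler_pM => //; [exact: le1|exact: le1].
  rewrite (_ : 6 * _ * _ = 36 * m%:R ^+ 4); last by ring.
  by rewrite mulrC ler_wpM2r // ler_weXn2l.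
apply: (@le_trans _ _ (\esum_(y in [set: site])
   ((36 * K)%:E * (g `|y.1 - x.1|%N * g `|y.2 - x.2|%N)%:E))%E).
  by apply: le_esum => y _; rewrite -EFinM lee_fin.
apply: le_trans (esum_mull_le _ _ _) _.
- by rewrite lee_fin mulr_ge0 // (le_trans _ K1).
- by move=> y; rewrite lee_fin mulr_ge0.
rewrite (_ : 144 * K = 36 * K * 4); last by ring.
rewrite [leRHS]EFinM; apply: lee_wpmul2l.
  by rewrite lee_fin mulr_ge0 // (le_trans _ K1).
rewrite (_ : setT = setT `*`` (fun=> setT)); last first.
  by apply/seteqP; split.
rewrite -(@esum_esum _ _ _ setT (fun=> setT)
  (fun a b => (g `|a - x.1|%N * g `|b - x.2|%N)%:E)); last first.
  by move=> a b _ _; rewrite lee_fin mulr_ge0.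
apply: (@le_trans _ _ (\esum_(a in [set: int]) (2%:E * (g `|a - x.1|%N)%:E))%E).
  apply: le_esum => a _; under eq_esum do rewrite EFinM.
  apply: le_trans (esum_mull_le _ _ _) _ => //; first by rewrite lee_fin.
    by move=> b; rewrite lee_fin.
  by rewrite muleC; apply: lee_wpmul2r; rewrite ?lee_fin.
apply: le_trans (esum_mull_le _ _ _) _ => //.
  by move=> a; rewrite lee_fin.
rewrite (_ : 4 = 2 * 2 :> R); last by ring.
by rewrite [leRHS]EFinM; apply: lee_wpmul2l; rewrite ?lee_fin.
Qed.

End LatticeSum.

(** * Reverse martingale convergence *)

Section ReverseMartingale.
Context {d : measure_display} {T : measurableType d} {R : realType}.
Variables (P : probability T R) (F : nat -> set (set T)).
Hypotheses (F_algebra : forall n, sigma_algebra setT (F n))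
  (F_measurable : forall n, F n `<=` measurable)
  (F_decr : forall m n, (m <= n)%N -> F n `<=` F m).

Let mF n A : F n A -> measurable A. Proof. exact: F_measurable. Qed.

Let fineD A B : measurable A -> measurable B -> A `&` B = set0 ->
  fine (P (A `|` B)) = fine (P A) + fine (P B).
Proof.
by move=> mA mB AB; rewrite probabilityU // fineD // probability_fin_num.
Qed.

(** The range of indices is finite so that a last occurrence exists; [late_cvg] lets [j] tend to
    infinity. *)
Let late (G : nat -> set T) m j : set T :=
  [set w | exists n, [/\ (m <= n)%N, (n <= m + j)%N & G n w]].

Let late_algebra G m j : (forall n, F n (G n)) -> F m (late G m j).
Proof.
move=> FG; apply: sigma_algebra_exists => // n.
rewrite (_ : [set w | _] = [set w | ((m <= n)%N /\ (n <= m + j)%N) /\ G n w]).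
  by apply: sigma_algebra_and => // -[mn _]; exact: F_decr mn _ (FG n).
by apply/seteqP; split=> w /=; [case=> ? ? ?|case=> [[? ?] ?]].
Qed.

(* Splitting [late G m j] according to the last index of occurrence is what
   makes each piece belong to the algebra of that index. *)
Let late_lower_bound (A : set T) (a : R) G m j : measurable A ->
  (forall n, F n (G n)) ->
  (forall n B, F n B -> B `<=` G n -> a * fine (P B) <= fine (P (A `&` B))) ->
  a * fine (P (late G m j)) <= fine (P (A `&` late G m j)).
Proof.
move=> mA FG aG; elim: j m => [|j IH] m.
  apply: (aG m); first exact: late_algebra.
  by move=> w [n []]; rewrite addn0 => mn nm; rewrite (@anti_leq m n) ?mn.
have FL := late_algebra m.+1 j FG.
have FD : F m (G m `\` late G m.+1 j).
  by apply: sigma_algebra_setD => //; exact: F_decr (leqnSn m) _ FL.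
have -> : late G m j.+1 = (G m `\` late G m.+1 j) `|` late G m.+1 j.
  apply/seteqP; split=> w.
    case=> n [mn nm Gn]; have [Lw|nLw] := pselect (late G m.+1 j w);
      first by right.
    left; split=> //; move: mn; rewrite leq_eqVlt => /predU1P[->//|mn].
    by exfalso; apply: nLw; exists n; rewrite addSnnS.
  case=> [[Gm _]|[n [mn nm Gn]]]; first by exists m; rewrite leqnn leq_addr.
  by exists n; rewrite (ltnW mn) -addSnnS.
have disj : (G m `\` late G m.+1 j) `&` late G m.+1 j = set0.
  by apply/seteqP; split=> w // [[]].
rewrite setIUr !fineD ?mulrDr; first last.
- exact: disj.
- exact: mF FL.
- exact: mF FD.
- by rewrite setIACA disj setI0.
- by apply: measurableI => //; exact: mF FL.
- by apply: measurableI => //; exact: mF FD.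
by apply: lerD => //; apply: (aG m) => // w [].
Qed.

Let late_cvg (G : nat -> set T) m (b : R) : (forall n, F n (G n)) ->
  (forall j, fine (P (late G m j)) <= b) ->
  (P [set w | exists2 n, (m <= n)%N & G n w] <= b%:E)%E.
Proof.
move=> FG bnd.
have mL j : measurable (late G m j) by apply: (mF (late_algebra m j FG)).
have -> : [set w | exists2 n, (m <= n)%N & G n w] = \bigcup_j late G m j.
  apply/seteqP; split=> w.
    by case=> n mn Gn; exists (n - m)%N => //; exists n; rewrite subnKC.
  by case=> j _ [n [mn _ Gn]]; exists n.
have nd : nondecreasing_seq (late G m).
  move=> i j ij; apply/subsetPset => w [n [mn ni Gn]]; exists n; split=> //.
  by rewrite (leq_trans ni) // leq_add2l.
have Pcvg : P (late G m j) @[j --> \oo] --> P (\bigcup_j late G m j).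
  exact: (@nondecreasing_cvg_mu _ _ _ P _ mL (bigcupT_measurable _ mL) nd).
rewrite -(cvg_lim _ Pcvg) //; apply: lime_le; first exact: cvgP Pcvg.
apply: nearW => j /=; rewrite -(fineK (probability_fin_num P (mL j))) lee_fin.
exact: bnd.
Qed.

(** Let [B] be the event that some [f n] with [m <= n <= m + j] exceeds [c + h]. The probability of
    [A] and [B] is at least [(c + h) * P B] by [late_lower_bound] and at most [c * P B + e] by
    mixing, so [P B <= e / h] uniformly in [j]. *)
Lemma cond_probability_mixing_cvg (A : set T) (f : nat -> T -> R) :
  measurable A -> (forall n, is_cond_probability P (F n) A (f n)) ->
  (forall e : R, 0 < e -> exists M, forall m, (M <= m)%N -> forall B, F m B ->
     `|fine (P (A `&` B)) - fine (P A) * fine (P B)| <= e) ->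
  {ae P, forall w, f n w @[n --> \oo] --> fine (P A)}.
Proof.
move=> mA fP mix; set c := fine (P A).
pose up (h : R) n := [set w | c + h < f n w].
pose dn (h : R) n := [set w | f n w < c - h].
have Fup h n : F n (up h n).
  have [+ _ _] := fP n => /(_ `]c + h, +oo[%classic (measurable_itv _)).
  by congr (F n _); apply/seteqP; split=> w; rewrite /up /= in_itv /= andbT.
have Fdn h n : F n (dn h n).
  have [+ _ _] := fP n => /(_ `]-oo, c - h[%classic (measurable_itv _)).
  by congr (F n _); apply/seteqP; split=> w; rewrite /dn /= in_itv.
have fint n B : F n B -> P.-integrable B (EFin \o f n).
  move=> FB; have [_ fi _] := fP n.
  by apply: integrableS fi => //; exact: mF FB.
have cint (r : R) B : measurable B -> P.-integrable B (EFin \o cst r).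
  move=> mB; exact: finite_measure_integrable_cst.
have fineM r B : measurable B -> (r%:E * P B = (r * fine (P B))%:E)%E.
  by move=> mB; rewrite EFinM fineK // probability_fin_num.
have up_bound h n B : F n B -> B `<=` up h n ->
    (c + h) * fine (P B) <= fine (P (A `&` B)).
  move=> FB Bup; have mB := mF FB; have [_ _ fA] := fP n.
  rewrite -lee_fin -fineM // fineK ?probability_fin_num //;
    last exact: measurableI.
  rewrite -fA // -integral_cst //.
  apply: (le_integral mB (cint _ _ mB) (fint _ _ FB)) => w /set_mem/Bup/ltW.
  by rewrite lee_fin.
(* [late_lower_bound] only treats lower bounds, so deviations below [c] are read as deviations of
   the complement of [A] above [1 - c]. *)
have dn_bound h n B : F n B -> B `<=` dn h n ->
    (1 - c + h) * fine (P B) <= fine (P (~` A `&` B)).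
  move=> FB Bdn; have mB := mF FB; have [_ _ fA] := fP n.
  have : fine (P (A `&` B)) <= (c - h) * fine (P B).
    rewrite -lee_fin -fineM // fineK ?probability_fin_num //;
      last exact: measurableI.
    rewrite -fA // -integral_cst //.
    apply: (le_integral mB (fint _ _ FB) (cint _ _ mB)) => w /set_mem/Bdn/ltW.
    by rewrite lee_fin.
  have : fine (P B) = fine (P (A `&` B)) + fine (P (~` A `&` B)).
    rewrite -fineD; first by rewrite -setIUl setUCr setTI.
    - exact: measurableI.
    - by apply: measurableI => //; exact: measurableC.
    - by rewrite setIACA setICr set0I.
  lra.
have up_late h e m (h0 : 0 < h) : (forall B, F m B ->
     `|fine (P (A `&` B)) - fine (P A) * fine (P B)| <= e) ->
    (P [set w | exists2 n, (m <= n)%N & up h n w] <= (e / h)%:E)%E.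
  move=> mixm; apply: late_cvg => // j.
  have := late_lower_bound m j mA (Fup h) (up_bound h).
  have := mixm _ (late_algebra m j (Fup h)); rewrite -/c ler_norml => /andP[_].
  rewrite ler_pdivlMr //; lra.
have dn_late h e m (h0 : 0 < h) : (forall B, F m B ->
     `|fine (P (A `&` B)) - fine (P A) * fine (P B)| <= e) ->
    (P [set w | exists2 n, (m <= n)%N & dn h n w] <= (e / h)%:E)%E.
  move=> mixm; apply: late_cvg => // j.
  have := late_lower_bound m j (measurableC mA) (Fdn h) (dn_bound h).
  have FL := late_algebra m j (Fdn h).
  have : fine (P (late (dn h) m j)) = fine (P (A `&` late (dn h) m j))
      + fine (P (~` A `&` late (dn h) m j)).
    rewrite -fineD; first by rewrite -setIUl setUCr setTI.
    - by apply: measurableI => //; exact: mF FL.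
    - by apply: measurableI; [exact: measurableC|exact: mF FL].
    - by rewrite setIACA setICr set0I.
  have := mixm _ FL; rewrite -/c ler_norml => /andP[+ _].
  rewrite ler_pdivlMr //; lra.
pose bad h m := [set w | exists2 n, (m <= n)%N & up h n w] `|`
  [set w | exists2 n, (m <= n)%N & dn h n w].
have mlate (G : nat -> set T) m : (forall n, F n (G n)) ->
    measurable [set w | exists2 n, (m <= n)%N & G n w].
  move=> FG; rewrite (_ : [set w | _] = [set w | exists n,
    (m <= n)%N /\ G n w]).
    apply: (sigma_algebra_exists (sigma_algebra_measurable T)) => n.
    apply: (sigma_algebra_and (sigma_algebra_measurable T)) => _.
    exact: mF (FG n).
  by apply/seteqP; split=> w [n]; [exists n|case; exists n].
have bad_null (k : nat) : P.-negligible (\bigcap_m bad k.+1%:R^-1 m).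
  set h := _^-1; have h0 : 0 < h by rewrite invr_gt0.
  have mbad : measurable (\bigcap_m bad h m).
    by apply: bigcapT_measurable => m; apply: measurableU; exact: mlate.
  apply/negligibleP => //; apply/eqP; rewrite eq_le measure_ge0 andbT.
  apply/lee_addgt0Pr => e e0; rewrite add0e.
  (* Each of the two deviations then has probability at most [e / 2]. *)
  have [|M HM] := mix (e * h / 2); first by rewrite divr_gt0 // mulr_gt0.
  apply: (@le_trans _ _ (P (bad h M))).
    apply: le_measure; rewrite ?inE //.
      by apply: measurableU; exact: mlate.
    by move=> w; apply.
  apply: le_trans (measureU2 _ _ _) _; [exact: mlate|exact: mlate|].
  have E : e = e * h / 2 / h + e * h / 2 / h.
    by field; exact: lt0r_neq0.
  rewrite [X in (_ <= X%:E)%E]E EFinD; apply: leeD.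
    by apply: up_late => // B; exact: HM.
  by apply: dn_late => // B; exact: HM.
apply: (negligibleS _ (negligible_bigcup bad_null)) => w /= ncvg.
apply: contrapT => nbad; apply: ncvg.
apply/cvgrPdist_le => e e0.
have [k ke] : exists k : nat, k.+1%:R^-1 <= e.
  exists (Num.truncn e^-1).
  by rewrite invf_ple ?posrE ?ltW // real_truncnS_gt // num_real.
have [m nb] : exists m, ~ bad k.+1%:R^-1 m w.
  apply/existsNP => badw; apply: nbad; exists k => // m _; exact: badw.
exists m => // n /= mn; rewrite ler_norml; apply/andP; split.
  rewrite leNgt; apply/negP => lt; apply: nb; left; exists n => //.
  by move: lt ke; rewrite /up /=; move: (_^-1) (f n w) => x y; lra.
rewrite leNgt; apply/negP => lt; apply: nb; right; exists n => //.
by move: lt ke; rewrite /dn /=; move: (_^-1) (f n w) => x y; lra.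
Qed.

End ReverseMartingale.

(** * Sources of randomness of a region *)

Lemma setI_closed_pair {T : Type} (A : set T) : setI_closed [set A; setT].
Proof.
by move=> B C [->|->] [->|->]; rewrite ?setIT ?setTI ?setIid;
  [left|left|left|right].
Qed.

Section Environment.
Context {d : measure_display} {T : measurableType d} {R : realType}.
Variables (P : probability T R) (E : T -> set {fset site})
  (arr : site -> nat -> T -> R) (sigma0 : T -> conf).

Definition init_part (U : set site) : set (set T) :=
  \bigcup_(x in U) [set [set w | sigma0 w x]; setT].

Definition edge_part (Q : set {fset site}) : set (set T) :=
  \bigcup_(e in Q) [set [set w | E w e]; setT].

Definition clock_part (U : set site) : set (set T) :=
  \bigcup_(x in U) clock_algebra (arr x).

(** Sites and edges are chosen separately: an edge belongs to two sites, and a single link sometimes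
    has to be isolated. *)
Definition region_algebra (U : set site) (Q : set {fset site}) : set (set T) :=
  <<s init_part U `|` edge_part Q `|` clock_part U >>.

Lemma sigma_algebra_region U Q : sigma_algebra setT (region_algebra U Q).
Proof. exact: smallest_sigma_algebra. Qed.

Lemma region_algebra_sub U U' Q Q' : U `<=` U' -> Q `<=` Q' ->
  region_algebra U Q `<=` region_algebra U' Q'.
Proof.
move=> UU' QQ'; apply: sub_sigma_algebra2 => B [[]|].
- by case=> x /UU' ? ?; left; left; exists x.
- by case=> e /QQ' ? ?; left; right; exists e.
- by case=> x /UU' ? ?; right; exists x.
Qed.

Lemma region_algebra_init U Q x : U x -> region_algebra U Q [set w | sigma0 w
  x].
Proof. by move=> Ux; apply: sub_sigma_algebra; left; left; exists x => //;
  left. Qed.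

Lemma region_algebra_edge U Q e : Q e -> region_algebra U Q [set w | E w e].
Proof. by move=> Qe; apply: sub_sigma_algebra; left; right; exists e => //;
  left. Qed.

Lemma region_algebra_clock U Q x n (B : set R) : U x -> measurable B ->
  region_algebra U Q (arr x n @^-1` B).
Proof.
move=> Ux mB; apply: sub_sigma_algebra; right; exists x => //.
apply: sub_sigma_algebra; exists n => //; exists B => //.
by rewrite setTI.
Qed.

Hypotheses (sigma0_law : symmetric_bernoulli P sigma0)
  (graph_measurable : graph_algebra E `<=` measurable)
  (clock_measurable : forall x, clock_algebra (arr x) `<=` measurable)
  (sigma0_graph_indep : independent2 P (init_algebra sigma0) (graph_algebra E))
  (clock_indep : independent2 P
     (<<s \bigcup_x clock_algebra (arr x) >>)
     (<<s init_algebra sigma0 `|` graph_algebra E >>))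
  (arr_indep : independent_algebras P (fun x => clock_algebra (arr x)))
  (E_indep : independent_events P (fun e => [set w | E w e])).

Let init_sub U : <<s init_part U >> `<=` init_algebra sigma0.
Proof.
apply: smallest_sub; first exact: smallest_sigma_algebra.
move=> _ [x _ [->|->]]; first by apply: sub_sigma_algebra; exists x.
exact: (sigma_algebra_setT (smallest_sigma_algebra _ _)).
Qed.

Let edge_sub Q : <<s edge_part Q >> `<=` graph_algebra E.
Proof.
apply: smallest_sub; first exact: smallest_sigma_algebra.
move=> _ [x _ [->|->]]; first by apply: sub_sigma_algebra; exists x.
exact: (sigma_algebra_setT (smallest_sigma_algebra _ _)).
Qed.

Let clock_sub U : <<s clock_part U >> `<=` <<s \bigcup_x clock_algebra (arr x)
  >>.
Proof. by apply: sub_sigma_algebra2 => B [x _ ?]; exists x. Qed.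

Let init_measurable : init_algebra sigma0 `<=` measurable.
Proof.
by case: sigma0_law => m0 _ _; apply: generated_measurable => _ [x ->].
Qed.

Let clocks_measurable : <<s \bigcup_x clock_algebra (arr x) >> `<=` measurable.
Proof. by apply: generated_measurable => B [x _]; exact: clock_measurable. Qed.

Lemma region_algebra_measurable U Q : region_algebra U Q `<=` measurable.
Proof.
apply: generated_measurable => B [[]|].
- by move=> HB; apply: init_measurable; apply: (@init_sub U);
  exact: sub_sigma_algebra.
- by move=> HB; apply: graph_measurable; apply: (@edge_sub Q);
  exact: sub_sigma_algebra.
- by move=> HB; apply: clocks_measurable; apply: (@clock_sub U);
  exact: sub_sigma_algebra.
Qed.

Let cells (U : set site) (Q : set {fset site}) : set (set T) :=
  [set B | exists a b c, [/\ <<s init_part U >> a, <<s edge_part Q >> b,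
    <<s clock_part U >> c & B = a `&` b `&` c]].

Let cells_setI U Q : setI_closed (cells U Q).
Proof.
move=> _ _ [a [b [c [sa sb sc ->]]]] [a' [b' [c' [sa' sb' sc' ->]]]].
exists (a `&` a'), (b `&` b'), (c `&` c'); split.
- by apply: (sigma_algebra_setI (smallest_sigma_algebra _ _)).
- by apply: (sigma_algebra_setI (smallest_sigma_algebra _ _)).
- by apply: (sigma_algebra_setI (smallest_sigma_algebra _ _)).
- by rewrite [LHS]setIACA [in LHS](setIACA a b).
Qed.

Let prob_cell a b c : init_algebra sigma0 a -> graph_algebra E b ->
  <<s \bigcup_x clock_algebra (arr x) >> c ->
  P (a `&` b `&` c) = (P a * P b * P c)%E.
Proof.
move=> sa sb sc; rewrite setIC clock_indep //.
  by rewrite sigma0_graph_indep // muleC.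
apply: (sigma_algebra_setI (smallest_sigma_algebra _ _));
  apply: sub_sigma_algebra; first by left.
by right.
Qed.

Let cells_measurable U Q : cells U Q `<=` measurable.
Proof.
move=> _ [a [b [c [/init_sub sa /edge_sub sb /clock_sub sc ->]]]].
apply: measurableI; first apply: measurableI.
- exact: init_measurable.
- exact: graph_measurable.
- exact: clocks_measurable.
Qed.

(** The three sources are independent of each other, and each is independent over disjoint index
    sets. On intersections of one event per source, the six factors can be regrouped by region;
    these intersections form a generating pi-system. *)
Lemma region_algebra_independent U U' Q Q' :
  U `&` U' = set0 -> Q `&` Q' = set0 ->
  independent2 P (region_algebra U Q) (region_algebra U' Q').
Proof.
move=> UU' QQ'.
have sub V W : region_algebra V W `<=` <<s cells V W >>.
  apply: sub_sigma_algebra2 => B BVW.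
  have sT G : <<s G >> [set: T] by exact: (sigma_algebra_setT
    (smallest_sigma_algebra _ _)).
  case: BVW => [[|]|] HB.
  - by exists B, setT, setT; split; rewrite ?setIT //; exact: sub_sigma_algebra.
  - by exists setT, B, setT; split; rewrite ?setIT ?setTI //;
    exact: sub_sigma_algebra.
  - by exists setT, setT, B; split; rewrite ?setTI //; exact: sub_sigma_algebra.
apply: (independent2_sub (@sub U Q) (@sub U' Q')).
apply: independent2_generated => //.
move=> _ _ [a [b [c [sa sb sc ->]]]] [a' [b' [c' [sa' sb' sc' ->]]]].
have initI : P (a `&` a') = (P a * P a')%E.
  have [m0 i0 _] := sigma0_law.
  apply: (independent_grouping _ _ _ (independent_events_algebras i0) UU') =>
    //.
  - by move=> x _ [->|->] //; exact: m0.
  - by move=> x; exact: setI_closed_pair.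
  - by move=> x; right.
have edgeI : P (b `&` b') = (P b * P b')%E.
  apply: (independent_grouping _ _ _ (independent_events_algebras E_indep) QQ')
    => //.
  - by move=> e _ [->|->] //; apply: graph_measurable;
    apply: sub_sigma_algebra; exists e.
  - by move=> x; exact: setI_closed_pair.
  - by move=> x; right.
have clockI : P (c `&` c') = (P c * P c')%E.
  apply: (independent_grouping clock_measurable _ _ arr_indep UU') => //.
  - by move=> x A B; apply: (sigma_algebra_setI (smallest_sigma_algebra _ _)).
  - by move=> x; exact: (sigma_algebra_setT (smallest_sigma_algebra _ _)).
have E1 := init_sub sa; have E2 := edge_sub sb; have E3 := clock_sub sc.
have E1' := init_sub sa'; have E2' := edge_sub sb'; have E3' := clock_sub sc'.
rewrite [X in P X](_ : _ = (a `&` a') `&` (b `&` b') `&` (c `&` c'));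
  last first.
  by rewrite setIACA (setIACA a b).
rewrite !prob_cell //; last 3 first.
- by apply: (sigma_algebra_setI (smallest_sigma_algebra _ _)).
- by apply: (sigma_algebra_setI (smallest_sigma_algebra _ _)).
- by apply: (sigma_algebra_setI (smallest_sigma_algebra _ _)).
rewrite initI edgeI clockI -!muleA; congr (_ * _)%E.
by rewrite muleCA; congr (_ * _)%E; rewrite [RHS]muleCA; congr (_ * _)%E;
  rewrite muleCA.
Qed.

End Environment.

(** * Chains of influence *)

(** Both ends must lie in [U]. An edge between [U] and its complement belongs to neither side, which
    keeps the two edge sets disjoint. *)
Definition pairs (U : set site) : set {fset site} :=
  [set e | exists x y, [/\ U x, U y & e = [fset x; y]%fset]].

Section Chains.
Context {d : measure_display} {T : measurableType d} {R : realType}.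
Variables (E : T -> set {fset site}) (arr : site -> nat -> T -> R) (dl : R).

Definition window (x : site) (i : nat) : set T :=
  [set w | exists n, i%:R * dl < arr x n w <= i.+1%:R * dl].

(* Backward influence: the update of [x] in a time window reads the value of a
   neighbour, which in turn was updated in the same or in an earlier window. *)
Fixpoint chain (w : T) (j : nat) (x : site) (p : seq site) : Prop :=
  if p is z :: p' then
    exists i, [/\ (i <= j)%N, window x i w, linked E x z w & chain w i z p']
  else True.

Lemma chain_mono w j j' x p : (j <= j')%N -> chain w j x p -> chain w j' x p.
Proof.
case: p => //= z p jj' [i [ij ? ? ?]]; exists i; split=> //.
exact: leq_trans jj'.
Qed.

Lemma chain_suffix w j x z p : x \in z :: p -> chain w j z p ->
  exists p', [/\ chain w j x p',
    last x p' = last z p & uniq (z :: p) -> uniq (x :: p')].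
Proof.
elim: p z j => [|u p IH] z j; first by rewrite inE => /eqP -> _; exists [::].
rewrite inE => /predU1P[-> zp|xp]; first by exists (u :: p).
case=> i [ij _ _ up]; have [p' [xp' lp' up']] := IH u i xp up.
exists p'; split=> //; first exact: chain_mono xp'.
by rewrite cons_uniq => /andP[_]; exact: up'.
Qed.

(** Loop erasure: the part of a chain after its return to [x] uses windows of index at most [j],
    hence is itself a chain from [x] at level [j]. *)
Lemma chain_uniq w j x p : chain w j x p ->
  exists p', [/\ chain w j x p', last x p' = last x p & uniq (x :: p')].
Proof.
elim: p x j => [|z p IH] x j; first by exists [::].
case=> i [ij xi xz zp]; have [p' [zp' lp' up']] := IH z i zp.
have [xp|xp] := boolP (x \in z :: p').
  have [p'' [xp'' lp'' up'']] := chain_suffix xp zp'.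
  exists p''; split; [exact: chain_mono xp''| |exact: up''].
  by rewrite /= lp''.
exists (z :: p'); split => //=; first by exists i.
by rewrite xp.
Qed.

Lemma chain_prefix w j x z p : z \in x :: p -> chain w j x p ->
  exists2 p', chain w j x p' & last x p' = z.
Proof.
elim: p x j => [|u p IH] x j; first by rewrite inE => /eqP -> _; exists [::].
rewrite inE => /predU1P[-> _|zp]; first by exists [::].
case=> i [ij xi xu up]; have [p' up' lp'] := IH u i zp up.
by exists (u :: p') => //; exists i.
Qed.

(** Testing the last site is enough: by [chain_prefix] every site on a chain is the end of a
    chain. *)
Definition confined (w : T) (j : nat) (x : site) (F : set site) :=
  forall p, chain w j x p -> F (last x p).

Lemma confined_mono w i j x F : (i <= j)%N -> confined w j x F -> confined w i
  x F.
Proof. by move=> ij jF p /(chain_mono ij); exact: jF. Qed.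

Lemma confined_step w i j x z F : (i <= j)%N -> window x i w -> linked E x z w
  ->
  confined w j x F -> confined w i z F.
Proof. by move=> ij xi xz jF p zp; apply: (jF (z :: p)); exists i. Qed.

Lemma confined_start w j x F : confined w j x F -> F x.
Proof. by move=> /(_ [::]); apply. Qed.

Variable sigma0 : T -> conf.

Local Notation region := (region_algebra E arr sigma0).

Lemma region_algebra_window U Q x i : U x -> region U Q (window x i).
Proof.
move=> Ux; apply: sigma_algebra_exists => [|n];
  first exact: (@sigma_algebra_region _ T R E arr sigma0 U Q).
rewrite (_ : [set w | _] = arr x n @^-1` `]i%:R * dl, i.+1%:R * dl]).
  exact: region_algebra_clock.
by apply/seteqP; split=> w /=; rewrite in_itv.
Qed.

Lemma region_algebra_chain (U : set site) j x p : (forall z,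
  z \in x :: p -> U z) ->
  region U (pairs U) [set w | chain w j x p].
Proof.
have RS := @sigma_algebra_region _ T _ E arr sigma0 U (pairs U).
elim: p x j => [|z p IH] x j xpU; first exact: (sigma_algebra_setT RS).
apply: (sigma_algebra_exists RS) => i.
rewrite (_ : [set w | _] = [set w | (i <= j)%N /\
    (window x i `&` linked E x z `&` [set w | chain w i z p]) w]).
  apply: (sigma_algebra_and RS) => _; apply: (sigma_algebra_setI RS) => //.
    apply: (sigma_algebra_setI RS) => //.
      by apply: region_algebra_window; apply: xpU; rewrite mem_head.
    apply: region_algebra_edge; exists x, z; split=> //; apply: xpU.
      by rewrite mem_head.
    by rewrite !inE eqxx orbT.
  by apply: IH => u up; apply: xpU; rewrite inE up orbT.
by apply/seteqP; split=> w /=; [case=> ? ? ? ?|case=> ? [[? ?] ?]].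
Qed.

(** Confinement itself looks at chains through the whole lattice. Restricted to chains inside [U],
    it becomes an event of the region [U], as a countable intersection over paths. *)
Lemma region_algebra_confined (U : set site) j x F :
  region U (pairs U) [set w | forall p, (forall z, z \in x :: p -> U z) ->
     chain w j x p -> F (last x p)].
Proof.
have RS := @sigma_algebra_region _ T _ E arr sigma0 U (pairs U).
apply: (sigma_algebra_forall RS) => p.
apply: (sigma_algebra_imply RS) => xpU.
have [Fl|nFl] := pselect (F (last x p)).
  rewrite [X in region _ _ X](_ : _ = setT);
    first exact: (sigma_algebra_setT RS).
  by apply/seteqP; split.
rewrite [X in region _ _ X](_ : _ = ~` [set w | chain w j x p]).
  apply: (sigma_algebra_setC RS) => //; exact: region_algebra_chain.
by apply/seteqP; split=> w /= wc // /wc.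
Qed.

End Chains.

(** * Probability of chains *)

Section ChainProbability.
Context {d : measure_display} {T : measurableType d} {R : realType}.
Variables (P : probability T R) (E : T -> set {fset site})
  (arr : site -> nat -> T -> R) (sigma0 : T -> conf) (dl eps : R).
Local Notation region := (region_algebra E arr sigma0).
Local Notation chain := (chain E arr dl).
Local Notation window := (window arr dl).
Local Notation confined := (confined E arr dl).

Hypotheses (region_measurable : forall U Q, region U Q `<=` measurable)
  (region_indep : forall U U' Q Q', U `&` U' = set0 -> Q `&` Q' = set0 ->
     independent2 P (region U Q) (region U' Q'))
  (eps_gt0 : 0 < eps)
  (window_le : forall x i, (P (window x i) <= eps%:E)%E).

Definition link_prob (x y : site) : R := fine (P (linked E x y)).

(** [eps] pays for the update of [x]; the 2 absorbs the sum over its possible windows. *)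
Definition chain_kernel (x y : site) : R := 2 * eps * link_prob x y.

Hypothesis kernel_row : forall x,
  (\esum_(y in [set: site]) (chain_kernel x y)%:E <= (2^-1)%:E)%E.

Let link_ge0 x y : 0 <= link_prob x y.
Proof. by apply: fine_ge0; exact: measure_ge0. Qed.

Let kernel_ge0 x y : 0 <= chain_kernel x y.
Proof. by rewrite !mulr_ge0 // ltW. Qed.

Let linkedC x y : linked E x y = linked E y x.
Proof. by rewrite /linked fsetUC. Qed.

Let kernel_col y :
  (\esum_(x in [set: site]) (chain_kernel x y)%:E <= (2^-1)%:E)%E.
Proof.
under eq_esum do rewrite /chain_kernel /link_prob linkedC.
exact: kernel_row.
Qed.

Let mlinked x y : measurable (linked E x y).
Proof.
apply: (@region_measurable setT setT); exact: region_algebra_edge.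
Qed.

Let mwindow x i : measurable (window x i).
Proof. by apply: (@region_measurable setT setT);
  exact: region_algebra_window. Qed.

Let mchain j x p : measurable [set w | chain w j x p].
Proof.
by apply: (@region_measurable setT (pairs setT)); exact: region_algebra_chain.
Qed.

Let linkE x y : P (linked E x y) = (link_prob x y)%:E.
Proof. by rewrite fineK // probability_fin_num. Qed.

Let weight := path_weight chain_kernel.

Let weight_ge0 x p : 0 <= weight x p.
Proof. exact: path_weight_ge0. Qed.

Let pairs_notin (x z : site) (U : set site) : ~ U x ->
  [set [fset x; z]%fset] `&` pairs U = set0.
Proof.
move=> nUx; apply/seteqP; split=> e // [/= -> [u [v [Uu Uv]]]].
move=> /fsetP /(_ x); rewrite !inE eqxx /= => /esym /orP[/eqP xu|/eqP xv].
  by apply: nUx; rewrite xu.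
by apply: nUx; rewrite xv.
Qed.

(** Since [x] does not recur, its clock and the edge to [z] are independent of the rest of the
    chain. Summing over the window [i <= j] of the first update gives a geometric sum below
    [2 * 2 ^+ j]. *)
Let prob_chain j x p : uniq (x :: p) ->
  (P [set w | chain w j x p] <= (2 ^+ j * weight x p)%:E)%E.
Proof.
elim: p x j => [|z p IH] x j xp.
  rewrite /weight /= mulr1 (le_trans (probability_le1 P (mchain j x [::]))) //.
  by rewrite lee_fin exprn_ege1 // ler1n.
pose B i := window x i `&` linked E x z `&` [set w | chain w i z p].
have mB i : measurable (B i) by apply: measurableI => //; exact: measurableI.
apply: (@le_trans _ _ (\esum_(i in `I_j.+1) P (B i))%E).
  apply: measure_bigcup_esum => //.
  by move=> w [i [ij xi xz zp]]; exists i.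
rewrite esum_fset //.
rewrite -fsbig_ord.
have /= : (forall i, P (B i) <= (2 ^+ i * (eps * link_prob x z * weight z
  p))%:E)%E.
  move=> i; have /andP[xzp uzp] : (x \notin z :: p) && uniq (z :: p) by [].
  have nx : ~ [set` z :: p] x by move=> /=; apply/negP.
  rewrite (@region_indep [set x] [set` z :: p] _ _ _ (pairs_notin z nx));
    first last.
  - exact: region_algebra_chain.
  - apply: (sigma_algebra_setI (@sigma_algebra_region _ T R E arr sigma0 _ _)).
      exact: region_algebra_window.
    exact: region_algebra_edge.
  - by apply/seteqP; split=> u // [/= -> /nx].
  rewrite (@region_indep [set x] set0 set0 [set [fset x; z]%fset]); first last.
  - exact: region_algebra_edge.
  - exact: region_algebra_window.
  - by rewrite set0I.
  - by rewrite setI0.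
  rewrite linkE (_ : 2 ^+ i * _ =
    eps * link_prob x z * (2 ^+ i * weight z p)); last by ring.
  rewrite [leRHS]EFinM; apply: lee_pmul.
  - by rewrite mule_ge0 // lee_fin.
  - exact: measure_ge0.
  - by rewrite EFinM; apply: lee_wpmul2r; rewrite ?lee_fin.
  - exact: IH.
move=> Ble.
apply: (@le_trans _ _ (\sum_(i < j.+1) (2 ^+ i * (eps * link_prob x z * weight
  z p))%:E)%E).
  by apply: lee_sum.
rewrite sumEFin lee_fin -mulr_suml /weight /= -/weight /chain_kernel.
have -> k : \sum_(i < k) 2 ^+ i = 2 ^+ k - 1 :> R.
  elim: k => [|k IHk]; first by rewrite big_ord0 expr0 subrr.
  by rewrite big_ord_recr /= IHk exprS; ring.
have c0 : 0 <= eps * link_prob x z * weight z p by rewrite !mulr_ge0 // ltW.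
rewrite exprS; set c := eps * link_prob x z * weight z p in c0 *.
rewrite (_ : 2 ^+ j * _ = 2 * 2 ^+ j * c); last by rewrite /c /weight; ring.
by rewrite ler_wpM2r // lerBlDr lerDl.
Qed.

(** The past of [x] contains the spins of its neighbours even if [x] is not updated, so the first
    step may be a bare link. *)
Let observed (j : nat) (z : site * seq site) : set T :=
  [set w | uniq (z.1 :: z.2) /\ (chain w j z.1 z.2 \/
     (if z.2 is y :: p then linked E z.1 y w /\ chain w j y p else False))].

Let mobserved j z : measurable (observed j z).
Proof.
case: z => x p; apply: (sigma_algebra_and (sigma_algebra_measurable T)) => _ /=.
apply: (@measurableU _ T _ _ (mchain j x p)).
case: p => [|y p]; first exact: (@measurable0 _ T).
exact: (measurableI _ _ (mlinked x y) (mchain j y p)).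
Qed.

(** A bare first link lacks the factor [2 * eps] of the kernel; its inverse appears in the
    constant. *)
Let prob_observed j x p :
  (P (observed j (x, p)) <= ((1 + (2 * eps)^-1) * 2 ^+ j * weight x p)%:E)%E.
Proof.
have e0 : 0 <= (2 * eps)^-1 by rewrite invr_ge0 mulr_ge0 // ltW.
have [uxp|nuxp] := boolP (uniq (x :: p)); last first.
  rewrite (_ : observed _ _ = set0).
    by rewrite measure0 lee_fin !mulr_ge0 // addr_ge0.
  by apply/seteqP; split=> w // [uxp]; case/negP: nuxp.
have := prob_chain j uxp.
case: p uxp => [|y p] uxp.
  move=> h1; apply: (@le_trans _ _ (P [set w | chain w j x [::]])).
    by apply: le_measure; rewrite ?inE // => w [_ []].
  apply: (le_trans h1); rewrite lee_fin -mulrA ler_peMl ?mulr_ge0 // lerDl //.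
move=> h1.
apply: (@le_trans _ _ (P [set w | chain w j x (y :: p)] +
    P (linked E x y `&` [set w | chain w j y p]))%E).
  apply: (@le_trans _ _ (P ([set w | chain w j x (y :: p)] `|`
      (linked E x y `&` [set w | chain w j y p])))).
    apply: le_measure; rewrite ?inE //.
      by apply: measurableU => //; exact: measurableI.
    by move=> w [_ []]; [left|right].
  by apply: measureU2 => //; exact: measurableI.
rewrite -mulrA mulrDl mul1r EFinD; apply: leeD => //.
have /andP[xyp uyp] : (x \notin y :: p) && uniq (y :: p) by [].
have nx : ~ [set` y :: p] x by move=> /=; apply/negP.
rewrite (@region_indep set0 [set` y :: p] _ _ _ (pairs_notin y nx)); first last.
- exact: region_algebra_chain.
- exact: region_algebra_edge.
- by rewrite set0I.
rewrite linkE /weight /= -/weight /chain_kernel.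
rewrite (_ : (2 * eps)^-1 * _ = link_prob x y * (2 ^+ j * weight y p));
  last first.
  by rewrite /weight; field; exact: lt0r_neq0.
rewrite EFinM; apply: lee_wpmul2l; first by rewrite lee_fin.
exact: prob_chain.
Qed.

Let mconfined j x (F : set site) : measurable [set w | confined w j x F].
Proof.
have := @region_algebra_confined _ _ _ E arr dl sigma0 setT j x F.
move=> /region_measurable; congr (measurable _).
by apply/seteqP; split=> w /= wF p; [move=> *; exact: wF|move=> ?; exact: wF].
Qed.

(** The expected number of chains from [x] without repeated sites is finite. Keeping finitely many
    paths leaves a tail at most [e], and [F] collects the ends of the kept paths. *)
Lemma confined_finite (e : R) j x : 0 < e ->
  exists2 F : set site, finite_set F &
    (P [set w | ~ confined w j x F] <= e%:E)%E.
Proof.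
move=> e0; pose a (p : seq site) := ((2 ^+ j)%:E * (weight x p)%:E)%E.
have a0 p : (0 <= a p)%E by rewrite mule_ge0 // lee_fin.
have aoo : (\esum_(p in [set: seq site]) a p < +oo)%E.
  apply: (@le_lt_trans _ _ ((2 ^+ j)%:E * 2%:E)%E); last by rewrite -EFinM ltry.
  apply: le_trans (esum_mull_le _ _ _) _.
  - by rewrite lee_fin.
  - by move=> p; rewrite lee_fin.
  - apply: lee_wpmul2l; first by rewrite lee_fin.
    exact: (esum_path_weight_from kernel_ge0 kernel_row).
have [G finG tailG] := esum_tail a0 aoo e0.
exists [set last x p | p in G]; first exact: finite_image.
pose B p := [set w | uniq (x :: p) /\ chain w j x p].
have mB p : measurable (B p).
  by apply: (sigma_algebra_and (sigma_algebra_measurable T)) => _;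
    exact: mchain.
apply: (le_trans _ tailG).
apply: (@le_trans _ _ (\esum_(p in setT `\` G) P (B p))%E).
  apply: measure_bigcup_esum => //; first by apply: measurableC;
    exact: mconfined.
  move=> w /= /existsNP[p /not_implyP[xp nG]].
  have [p' [xp' lp' up']] := chain_uniq xp.
  exists p' => //; split=> // Gp'; apply: nG; exists p' => //.
apply: le_esum => p _; rewrite /a -EFinM.
have [up|nup] := boolP (uniq (x :: p)).
  apply: le_trans (prob_chain j up); apply: le_measure; rewrite ?inE //.
  by move=> w [].
rewrite (_ : B p = set0); first by rewrite measure0 lee_fin mulr_ge0.
by apply/seteqP; split=> w // [up]; case/negP: nup.
Qed.

Lemma confined_finite_set (e : R) j (V : set site) : finite_set V -> 0 < e ->
  exists2 F : set site, finite_set F & (exists2 N, measurable N &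
    (P N <= e%:E)%E /\ forall w, ~ N w -> forall x, V x -> confined w j x F).
Proof.
case/finite_seqP=> s ->; elim: s e => [|v s IH] e e0.
  exists set0 => //; exists set0 => //.
  by rewrite measure0 lee_fin ltW.
have e2 : 0 < e / 2 by rewrite divr_gt0.
have [F1 fin1 P1] := confined_finite j v e2.
have [F2 fin2 [N mN [PN HN]]] := IH _ e2.
exists (F1 `|` F2); first by rewrite finite_setU.
exists ([set w | ~ confined w j v F1] `|` N).
  by apply: measurableU => //; apply: measurableC; exact: mconfined.
split.
  apply: le_trans (measureU2 _ _ mN) _; first by apply: measurableC;
    exact: mconfined.
  by rewrite (splitr e) EFinD; exact: leeD.
move=> w /not_orP[/contrapT wF1 /HN wF2] x /=;
  rewrite inE => /predU1P[->|xs] p xp.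
  by left; exact: wF1.
by right; apply: (wF2 x).
Qed.

(** The type [{fset site}] is countable, so the existence of a random finite confining set is a
    measurable event. *)
Lemma confined_negligible j x :
  P.-negligible [set w | ~ exists F : {fset site}, confined w j x [set` F]].
Proof.
set D := [set w | _].
have mD : measurable D.
  apply: (sigma_algebra_setC (sigma_algebra_measurable T)).
  exact: (sigma_algebra_exists (sigma_algebra_measurable T)).
apply/negligibleP => //; apply/eqP; rewrite eq_le measure_ge0 andbT.
apply/lee_addgt0Pr => e e0; rewrite add0e.
have [F finF PF] := confined_finite j x e0.
apply: le_trans PF; apply: le_measure; rewrite ?inE //;
  first by apply: measurableC; exact: mconfined.
move=> w nw wF; apply: nw; exists (fset_set F).
by move=> p /wF Fp; rewrite /= in_fset_set // inE.
Qed.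

Definition influences (w : T) (j : nat) (x : site) (V : set site) :=
  exists y p, [/\ y = x \/ linked E x y w, chain w j y p & V (last y p)].

Lemma measurable_influences j (U V : set site) :
  measurable [set w | exists2 x, U x & influences w j x V].
Proof.
have ST := sigma_algebra_measurable T.
rewrite (_ : [set w | _] = [set w | exists x, U x /\ (exists y, exists p,
    V (last y p) /\ ([set w | y = x] `|` linked E x y) w /\ chain w j y p)]);
      last first.
  apply/seteqP; split=> w [x].
    by move=> Ux [y [p [yx yp Vp]]]; exists x; split=> //; exists y, p.
  by move=> [Ux [y [p [Vp [yx yp]]]]]; exists x => //; exists y, p.
apply: (sigma_algebra_exists ST) => x; apply: (sigma_algebra_and ST) => Ux.
apply: (sigma_algebra_exists ST) => y; apply: (sigma_algebra_exists ST) => p.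
apply: (sigma_algebra_and ST) => Vp.
apply: (sigma_algebra_setI ST); last exact: mchain.
apply: (sigma_algebra_setU ST) => //.
exact: (sigma_algebra_constant _ ST).
Qed.

Let influence_observed w j x v : influences w j x [set v] ->
  exists2 p, last x p = v & observed j (x, p) w.
Proof.
move=> [y [p [yx yp vp]]]; have [p' [yp' lp' up']] := chain_uniq yp.
have [xp'|xp'] := boolP (x \in y :: p').
  have [p'' [xp'' lp'' up'']] := chain_suffix xp' yp'.
  by exists p''; [rewrite lp'' lp'|split; [exact: up''|left]].
case: yx => [yx|xy]; first by rewrite -yx mem_head in xp'.
exists (y :: p'); first by rewrite /= lp'.
by split; [rewrite /= xp'|right].
Qed.

(** Here the tail is taken among all pairs of a start and a path with a given end in [V], so a
    single estimate covers every start outside [F] at once. *)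
Lemma influences_finite (e : R) j (V : set site) : finite_set V -> 0 < e ->
  exists2 F : set site, finite_set F &
    (P [set w | exists2 x, ~ F x & influences w j x V] <= e%:E)%E.
Proof.
move=> finV e0.
have single v (e' : R) : 0 < e' -> exists2 F : set site, finite_set F &
    (P [set w | exists2 x, ~ F x & influences w j x [set v]] <= e'%:E)%E.
  move=> e0'; pose c := (1 + (2 * eps)^-1) * 2 ^+ j.
  have c0 : 0 <= c by rewrite mulr_ge0 // addr_ge0 // invr_ge0 mulr_ge0 // ltW.
  pose a (z : site * seq site) := (c%:E * (weight z.1 z.2)%:E)%E.
  have a0 z : (0 <= a z)%E by rewrite mule_ge0 // lee_fin.
  pose J := [set z : site * seq site | last z.1 z.2 = v].
  have aoo : (\esum_(z in J) a z < +oo)%E.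
    apply: (@le_lt_trans _ _ (c%:E * 2%:E)%E); last by rewrite -EFinM ltry.
    apply: le_trans (esum_mull_le _ _ _) _.
    - by rewrite lee_fin.
    - by move=> p; rewrite lee_fin.
    - apply: lee_wpmul2l; first by rewrite lee_fin.
      exact: (esum_path_weight_to kernel_ge0 kernel_col).
  have [G finG tailG] := esum_tail a0 aoo e0'.
  exists [set z.1 | z in G]; first exact: finite_image.
  apply: (le_trans _ tailG).
  apply: (@le_trans _ _ (\esum_(z in J `\` G) P (observed j z))%E).
    apply: measure_bigcup_esum => //.
      exact: (measurable_influences j (fun x => ~ _)).
    move=> w [x nF /influence_observed[p lp xp]].
    exists (x, p) => //; split=> // Gxp; apply: nF; exists (x, p) => //.
  apply: le_esum => -[x p] _; rewrite /a -EFinM; exact: prob_observed.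
case/finite_seqP: finV => s ->; elim: s e e0 => [|v s IH] e e0.
  exists set0 => //; rewrite (_ : [set w | _] = set0).
    by rewrite measure0 lee_fin ltW.
  by apply/seteqP; split=> w // [x _ [y [p [_ _]]]].
have e2 : 0 < e / 2 by rewrite divr_gt0.
have [F1 fin1 P1] := single v _ e2.
have [F2 fin2 P2] := IH _ e2.
exists (F1 `|` F2); first by rewrite finite_setU.
rewrite (splitr e) EFinD; apply: le_trans (leeD P1 P2).
set D1 := [set w | _] in P1 *; set D2 := [set w | _] in P2 *.
have mD1 : measurable D1 by exact: (measurable_influences j (fun x => ~ F1 x)).
have mD2 : measurable D2 by exact: (measurable_influences j (fun x => ~ F2 x)).
apply: (le_trans _ (measureU2 _ mD1 mD2)); apply: le_measure; rewrite ?inE.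
- exact: (measurable_influences j (fun x => ~ (F1 `|` F2) x)).
- exact: measurableU.
- move=> w [x /not_orP[nF1 nF2] [y [p [yx yp]]]].
  rewrite /= inE => /predU1P[lp|lp].
    by left; exists x => //; exists y, p.
  by right; exists x => //; exists y, p.
Qed.

End ChainProbability.

(** * Local determinism of the spins *)

Section Determinism.
Context {d : measure_display} {T : measurableType d} {R : realType}.
Variables (E : T -> set {fset site}) (arr : site -> nat -> T -> R)
  (sigma0 : T -> conf) (sigma : R -> T -> conf) (dl : R).
Local Notation region := (region_algebra E arr sigma0).
Local Notation confined := (confined E arr dl).
Local Notation window := (window arr dl).

Hypotheses (sigma_init : forall w, sigma 0 w = sigma0 w)
  (sigma_jumps : forall w x (s t : R), 0 <= s -> s <= t ->
     (forall n, ~ (s < arr x n w /\ arr x n w <= t)) ->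
     sigma t w x = sigma s w x)
  (sigma_local : forall x n,
     local_past E sigma x (arr x n) [set w | sigma (arr x n w) w x]).

Definition regular_clocks (w : T) := forall x,
  (forall m n, (m <= n)%N -> arr x m w <= arr x n w) /\
  (forall u : R, exists n, u < arr x n w).

Let arrived (s : R) (w : T) (z : site * nat) := 0 < arr z.1 z.2 w <= s.

(** Counting through lists without repetition makes this a countable intersection of clock
    events. *)
Let fewer_arrivals (F : set site) (N : nat) (s : R) : set T :=
  [set w | forall q : seq (site * nat), uniq q ->
     (forall z, z \in q -> F z.1 /\ arrived s w z) -> (size q < N)%N].

Let tame (F : set site) (N j : nat) (y : site) (s : R) : set T :=
  [set w | [/\ confined w j y F, fewer_arrivals F N s w & regular_clocks w]].

Section Step.
Variables (F : set site) (y : site) (s : R) (j N : nat).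
Hypotheses (Fy : F y) (s0 : 0 <= s) (sj : s <= j.+1%:R * dl).

Let M : set T :=
  tame F N.+1 j y s.

Let last_update (n i : nat) : set T :=
  [set w | [/\ 0 < arr y n w <= s, s < arr y n.+1 w &
               i%:R * dl < arr y n w <= i.+1%:R * dl]].

Let no_update : set T := [set w | forall n, ~ arrived s w (y, n)].

Let last_update_exists w : M w -> ~ no_update w ->
  exists n i, (i <= j)%N /\ last_update n i w.
Proof.
move=> [_ _ /(_ y)[mono unb]] /existsNP[k /contrapT /andP[/= k0 ks]].
(* The first arrival after [s] is not number 0, because [k] precedes it; its predecessor is the last
   update. *)
case: (ex_minnP (unb s)) => m sm minm.
have km : (k < m)%N.
  rewrite ltnNge; apply/negP => /mono mk.
  by have := lt_le_trans sm (le_trans mk ks); rewrite ltxx.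
case: m sm minm km => // n sn minn kn.
have n0 : 0 < arr y n w by exact: lt_le_trans k0 (mono k n kn).
have ns : arr y n w <= s by rewrite leNgt; apply/negP => /minn; rewrite ltnn.
have ex : exists i, arr y n w <= i.+1%:R * dl by exists j; exact: le_trans sj.
case: (ex_minnP ex) => i ni mini; exists n, i; split.
  by apply: mini; exact: le_trans sj.
split=> //; first by rewrite n0.
rewrite ni andbT; case: i {ni} mini => [|i] mini; first by rewrite mul0r.
by rewrite ltNge; apply/negP => /mini; rewrite ltnn.
Qed.

Let sigma_last_update w n i : M w -> last_update n i w ->
  sigma s w y = sigma (arr y n w) w y.
Proof.
move=> [_ _ /(_ y)[mono _]] [/andP[n0 ns] sn _]; apply: sigma_jumps => //.
  exact: ltW.
move=> k [nk ks]; have [kn|kn] := leqP k n.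
  by have := lt_le_trans nk (mono k n kn); rewrite ltxx.
by have := le_lt_trans (le_trans (mono n.+1 k kn) ks) sn; rewrite ltxx.
Qed.

Let sigma_no_update w : no_update w -> sigma s w y = sigma0 w y.
Proof.
move=> nu; rewrite -sigma_init; apply: sigma_jumps => // n [n0 ns].
by apply: (nu n); rewrite /arrived /= n0.
Qed.

Let RS : sigma_algebra setT (region F (pairs F)) := @sigma_algebra_region _ T R
  E arr sigma0 F (pairs F).

Let arr_le x n u : F x -> region F (pairs F) [set w | arr x n w <= u].
Proof.
move=> Fx; rewrite (_ : [set w | _] = arr x n @^-1` `]-oo, u]).
  exact: region_algebra_clock.
by apply/seteqP; split=> w /=; rewrite in_itv.
Qed.

Let arr_gt x n u : F x -> region F (pairs F) [set w | u < arr x n w].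
Proof.
move=> Fx; rewrite (_ : [set w | _] = arr x n @^-1` `]u, +oo[).
  exact: region_algebra_clock.
by apply/seteqP; split=> w /=; rewrite in_itv /= andbT.
Qed.

Let arr_itv x n u v : F x -> region F (pairs F) [set w | u < arr x n w <= v].
Proof.
move=> Fx; rewrite (_ : [set w | _] = [set w | u < arr x n w] `&` [set w | arr
  x n w <= v]).
  by apply: (sigma_algebra_setI RS); [exact: arr_gt|exact: arr_le].
by apply/seteqP; split=> w /=; [move=> /andP[]|move=> [-> ->]].
Qed.

Let region_last_update n i : region F (pairs F) (last_update n i).
Proof.
rewrite (_ : last_update n i = [set w | 0 < arr y n w <= s] `&`
   [set w | s < arr y n.+1 w] `&` [set w | i%:R * dl < arr y n w <= i.+1%:R *
     dl]).
  apply: (sigma_algebra_setI RS); last exact: arr_itv.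
  by apply: (sigma_algebra_setI RS); [exact: arr_itv|exact: arr_gt].
by apply/seteqP; split=> w; [case|case=> -[]].
Qed.

Let region_no_update : region F (pairs F) no_update.
Proof.
apply: (sigma_algebra_forall RS) => n; apply: (sigma_algebra_setC RS).
exact: arr_itv.
Qed.

Hypothesis IH : forall z i s', 0 <= s' -> s' <= i.+1%:R * dl ->
  agree_on (tame F N i z s')
    (region F (pairs F)) [set w | sigma s' w z].

Let agree_empty (K A : set T) : A `&` K = set0 -> agree_on K (region F (pairs
  F)) A.
Proof.
by move=> AK; exists set0; [case: RS|rewrite set0I].
Qed.

(** The update sees only spins at earlier times, to which the induction hypothesis applies; it
    suffices to treat the generators of the past. *)
Let agree_local_past n i : (i <= j)%N ->
  local_past E sigma y (arr y n) `<=`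
  agree_on (M `&` last_update n i) (region F (pairs F)).
Proof.
move=> ij; apply: smallest_sub; first exact: sigma_algebra_agree_on.
move=> _ [z [s' [a [s'0 ->]]]].
have [s'i|is'] := leP s' (i.+1%:R * dl); last first.
  apply: agree_empty; apply/seteqP;
    split=> w // [[_ [s'n _]] [_ [_ _ /andP[_ ni]]]].
  by have := lt_le_trans is' (le_trans (ltW s'n) ni); rewrite ltxx.
have next w : (linked E y z w \/ z = y) -> (M `&` last_update n i) w ->
    confined w i z F.
  move=> yz [[yF _ _] [_ _ ni]]; case: yz => [yz|->].
    by apply: (confined_step ij _ yz yF); exists n.
  exact: confined_mono yF.
(* Reading a neighbour outside [F] would extend a chain out of [F]. Edges leaving [F] thus never
   have to be examined. *)
have [Fz|nFz] := pselect (F z); last first.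
  apply: agree_empty; apply/seteqP; split=> w // [[yz _] Mw].
  by apply: nFz; exact: confined_start (next _ yz Mw).
have : agree_on (tame F N i z s')
    (region F (pairs F)) [set w | sigma s' w z = a].
  case: a; first exact: IH.
  rewrite [X in agree_on _ _ X](_ : _ = ~` [set w | sigma s' w z]).
    exact: (sigma_algebra_setC (sigma_algebra_agree_on _ RS) (IH z s'0 s'i)).
  by apply/seteqP; split=> w /=; [move=> ->|move/negP/negbTE].
move=> [B SB BE].
exists ((linked E y z `|` [set w | z = y]) `&` [set w | s' < arr y n w] `&` B).
  apply: (sigma_algebra_setI RS) => //; apply: (sigma_algebra_setI RS);
    last exact: arr_gt.
  apply: (sigma_algebra_setU RS).
    by apply: region_algebra_edge; exists y, z.
  exact: (sigma_algebra_constant _ RS).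
have few w : (linked E y z w \/ z = y) -> s' < arr y n w -> (M `&` last_update
  n i) w ->
    (sigma s' w z = a <-> B w).
  move=> yz s'n Mw; have [[yF few reg] [/andP[n0 ns] _ _]] := Mw.
  have K : [/\ confined w i z F, fewer_arrivals F N s' w & regular_clocks w].
    split=> //; first exact: next.
    (* The arrival [(y, n)] comes after time [s'] and can be added to any list of arrivals up to
       [s']: the count drops by one. *)
    move=> q uq Fq; rewrite -ltnS; apply: (few ((y, n) :: q)).
      rewrite /= uq andbT; apply/negP => /Fq[_ /andP[_ /= ns']].
      by have := lt_le_trans s'n ns'; rewrite ltxx.
    move=> u; rewrite inE => /predU1P[->|/Fq[Fu /andP[u0 us']]].
      by split=> //; rewrite /arrived /= n0.
    split=> //; rewrite /arrived u0 (le_trans us') // (le_trans (ltW s'n)) //.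
  split=> [sa|Bw].
    suff [] : (B `&` tame F N i z s') w by [].
    by rewrite -BE.
  suff [] : ([set w | sigma s' w z = a] `&` tame F N i z s') w by [].
  by rewrite BE.
apply/seteqP; split=> w.
  by move=> [[yz [s'n sa]] Mw]; split=> //; split=> //; exact/(few w yz s'n Mw).
move=> [[[yz s'n] Bw] Mw]; split=> //; split=> //; split=> //.
exact/(few w yz s'n Mw).
Qed.

Lemma agree_spin_step : agree_on M (region F (pairs F)) [set w | sigma s w y].
Proof.
have /choice [B HB] : forall z : nat * nat, exists B, region F (pairs F) B /\
    ((z.2 <= j)%N -> [set w | sigma (arr y z.1 w) w y] `&` (M `&` last_update
      z.1 z.2) =
      B `&` (M `&` last_update z.1 z.2)).
  move=> [n i]; have [ij|ij] := leqP i j.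
    by have [B SB BE] := agree_local_past ij (@sigma_local y n); exists B.
  (* Default value: for [i > j] the condition is vacuous. *)
  by exists set0; split; [case: RS|].
have SB z : region F (pairs F) (B z) by case: (HB z).
have BE n i w : (i <= j)%N -> M w -> last_update n i w ->
    (sigma (arr y n w) w y <-> B (n, i) w).
  move=> ij Mw Lw; have [_ /(_ ij) E1] := HB (n, i); split=> H1.
    by have [] : (B (n, i) `&` (M `&` last_update n i)) w by rewrite -E1.
  by have [] : ([set w | sigma (arr y n w) w y] `&` (M `&` last_update n i)) w
    by rewrite E1.
exists ((no_update `&` [set w | sigma0 w y]) `|`
  \bigcup_(z in [set: nat * nat]) [set w | (z.2 <= j)%N /\ (last_update z.1 z.2
    `&` B z) w]).
  apply: (sigma_algebra_setU RS).
    by apply: (sigma_algebra_setI RS) => //; exact: region_algebra_init.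
  apply: (sigma_algebra_bigcupT RS) => z; apply: (sigma_algebra_and RS) => _.
  exact: (sigma_algebra_setI RS).
apply/seteqP; split=> w [sw Mw]; split=> //.
  have [nu|nu] := pselect (no_update w).
    by left; split=> //; rewrite /= -sigma_no_update.
  have [n [i [ij Lw]]] := last_update_exists Mw nu.
  right; exists (n, i) => //; split=> //; split=> //; apply/(BE n i w) => //.
  by rewrite -(sigma_last_update Mw Lw).
case: sw => [[nu s0w]|[[n i] _ [/= ij [Lw Bw]]]].
  by rewrite /= sigma_no_update.
by rewrite /= (sigma_last_update Mw Lw); apply/(BE n i w).
Qed.

End Step.

Lemma agree_spin_few_arrivals F N y j s : 0 <= s -> s <= j.+1%:R * dl ->
  agree_on (tame F N j y s)
    (region F (pairs F)) [set w | sigma s w y].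
Proof.
have empty (K A : set T) : K = set0 -> agree_on K (region F (pairs F)) A.
  by move=> ->; exists set0;
    [case: (@sigma_algebra_region _ T R E arr sigma0 F (pairs F))|rewrite
      !setI0].
elim: N y j s => [|N IH] y j s s0 sj.
  (* Even the empty list has size 0, so fewer than 0 arrivals is impossible. *)
  apply: empty; apply/seteqP; split=> w // [_ few _].
  suff : (size ([::] : seq (site * nat)) < 0)%N by [].
  by apply: few => // z; rewrite in_nil.
have [Fy|nFy] := pselect (F y); first exact: agree_spin_step.
by apply: empty; apply/seteqP; split=> w // [/confined_start].
Qed.

Let few_arrivals F s w : finite_set F -> regular_clocks w ->
  exists N, fewer_arrivals F N s w.
Proof.
move=> /finite_seqP[l ->] reg.
have /choice[m Hm] x : exists n, s < arr x n w by have [_ unb] := reg x;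
  exact: unb.
exists (size [seq (x, n) | x <- l, n <- iota 0 (m x)]).+1 => q uq Hq.
rewrite ltnS; apply: uniq_leq_size => // -[x n] /Hq [/= lx /andP[_ /= ns]].
apply/allpairsPdep; exists x, n; split=> //.
rewrite mem_iota /= add0n ltnNge; apply/negP => mn; have [mono _] := reg x.
by have := lt_le_trans (Hm x) (le_trans (mono _ _ mn) ns); rewrite ltxx.
Qed.

(** Regular clocks ring finitely often in a finite [F] up to time [s], so the local events found for
    each bound [N] can be glued along the local events [fewer_arrivals F N s]. *)
Lemma agree_spin F y j s : finite_set F -> 0 <= s -> s <= j.+1%:R * dl ->
  agree_on [set w | confined w j y F /\ regular_clocks w]
    (region F (pairs F)) [set w | sigma s w y].
Proof.
move=> finF s0 sj.
have RS := @sigma_algebra_region _ T R E arr sigma0 F (pairs F).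
have /choice [B HB] N : exists B, region F (pairs F) B /\
    [set w | sigma s w y] `&` tame F N j y s =
    B `&` tame F N j y s.
  by have [B ? ?] := @agree_spin_few_arrivals F N y j s s0 sj; exists B.
have BE N w : confined w j y F -> fewer_arrivals F N s w -> regular_clocks w ->
    (sigma s w y <-> B N w).
  move=> cw fw rw; have [_ /seteqP[E1 E2]] := HB N; split=> H1.
    by have [] : (B N `&` tame F N j y s) w
      by apply: E1.
  by have [] : ([set w | sigma s w y] `&` tame F N j y s) w
    by apply: E2.
exists (\bigcup_N (B N `&` fewer_arrivals F N s)).
  apply: (sigma_algebra_bigcupT RS) => N; apply: (sigma_algebra_setI RS).
    by case: (HB N).
  apply: (sigma_algebra_forall RS) => q; apply: (sigma_algebra_imply RS) => uq.
  have [sq|sq] := ltnP (size q) N.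
    rewrite [X in region _ _ X](_ : _ = setT);
      first exact: (sigma_algebra_setT RS).
    by apply/seteqP; split.
  rewrite [X in region _ _ X](_ : _ =
      ~` [set w | forall z, z \in q -> (F z.1 /\ arrived s w z)]).
    apply: (sigma_algebra_setC RS); apply: (sigma_algebra_forall RS) => -[x n].
    apply: (sigma_algebra_imply RS) => _; apply: (sigma_algebra_and RS) => Fx.
    rewrite [X in region _ _ X](_ : _ = arr x n @^-1` `]0, s]).
      exact: region_algebra_clock.
    by apply/seteqP; split=> w; rewrite /arrived /= in_itv.
  apply/seteqP; split=> w /= wq; first by move=> /wq.
  by move=> /wq.
apply/seteqP; split=> w [sw [cw rw]]; split=> //.
  have [N fN] := few_arrivals s finF rw.
  by exists N => //; split=> //; apply/(BE N w).
by case: sw => N _ [BN fN]; apply/(BE N w).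
Qed.

End Determinism.

(** * Spatial mixing *)

Lemma negligible_bigcup_countable {d : measure_display} {T : measurableType d}
    {R : realType} (mu : {measure set T -> \bar R}) (I : countType) (F : I ->
      set T) :
  (forall i, mu.-negligible (F i)) -> mu.-negligible (\bigcup_i F i).
Proof.
move=> nF.
pose G n := if @choice.unpickle I n is Some i then F i else set0.
rewrite (_ : \bigcup_i F i = \bigcup_n G n).
  apply: negligible_bigcup => n; rewrite /G.
  by case: choice.unpickle => // ; exact: negligible_set0.
apply/seteqP; split=> w.
  by case=> i _ Fi; exists (choice.pickle i) => //; rewrite /G choice.pickleK.
by case=> n _; rewrite /G; case: choice.unpickle => // i Fi; exists i.
Qed.

Section Mixing.
Context {d : measure_display} {T : measurableType d} {R : realType}.
Variables (P : probability T R) (E : T -> set {fset site})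
  (arr : site -> nat -> T -> R) (sigma0 : T -> conf) (sigma : R -> T -> conf)
  (dl eps : R).
Local Notation region := (region_algebra E arr sigma0).
Local Notation chain := (chain E arr dl).
Local Notation window := (window arr dl).
Local Notation confined := (confined E arr dl).
Local Notation influences := (influences E arr dl).

Hypotheses (region_measurable : forall U Q, region U Q `<=` measurable)
  (region_indep : forall U U' Q Q', U `&` U' = set0 -> Q `&` Q' = set0 ->
     independent2 P (region U Q) (region U' Q'))
  (eps_gt0 : 0 < eps)
  (window_le : forall x i, (P (window x i) <= eps%:E)%E)
  (kernel_row : forall x,
     (\esum_(y in [set: site]) (chain_kernel P E eps x y)%:E <= (2^-1)%:E)%E)
  (sigma_init : forall w, sigma 0 w = sigma0 w)
  (sigma_jumps : forall w x (s t : R), 0 <= s -> s <= t ->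
     (forall n, ~ (s < arr x n w /\ arr x n w <= t)) ->
     sigma t w x = sigma s w x)
  (sigma_local : forall x n,
     local_past E sigma x (arr x n) [set w | sigma (arr x n w) w x])
  (sigma_measurable : forall s x, 0 <= s -> measurable [set w | sigma s w x])
  (regular_negligible : P.-negligible [set w | ~ regular_clocks arr w]).

Let spin_true S (K : set T) s y : sigma_algebra setT S ->
  agree_on K S [set w | sigma s w y] ->
  forall a, agree_on K S [set w | sigma s w y = a].
Proof.
move=> RS sy [] //; rewrite [X in agree_on _ _ X](_ : _ = ~` [set w | sigma s w
  y]).
  exact: (sigma_algebra_setC (sigma_algebra_agree_on _ RS) sy).
by apply/seteqP; split=> w /=; [move=> ->|move/negP/negbTE].
Qed.

(** An observed spin has a finite but random confining set. If [V] does not influence [W], that set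
    can be chosen outside [V], and a countable union over its possible values gives an event of the
    complement of [V]. *)
Lemma region_past_agree (V W : set site) j t : t <= j.+1%:R * dl ->
  W `&` V = set0 ->
  region_past E sigma W t `<=`
  agree_on [set w | [/\ regular_clocks arr w,
      forall y, exists F : {fset site}, confined w j y [set` F] &
      ~ exists2 x, W x & influences w j x V]]
    (region (~` V) (pairs (~` V))).
Proof.
move=> tj WV; set M := [set w | _].
have RS := @sigma_algebra_region _ T R E arr sigma0 (~` V) (pairs (~` V)).
apply: smallest_sub; first exact: sigma_algebra_agree_on.
move=> B [x Wx]; move: B; apply: smallest_sub;
  first exact: sigma_algebra_agree_on.
move=> _ [y [s [a [s0 ->]]]].
have empty (A : set T) : A `&` M = set0 -> agree_on M (region (~` V) (pairs (~`
  V))) A.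
  by move=> AM; exists set0; [case: RS|rewrite set0I].
have Vx : ~ V x by move=> Vx; have : (W `&` V) x by []; rewrite WV.
(* Reading a site of [V] directly is already an influence, with the empty chain. *)
have [Vy|Vy] := pselect (V y).
  apply: empty; apply/seteqP; split=> w // [[xy _] [_ _ nI]].
  apply: nI; exists x => //; exists y, [::]; split=> //.
  by case: xy; [right|left].
have [st|ts] := ltP s t; last first.
  by apply: empty; apply/seteqP; split=> w // [[_ []]].
pose K := M `&` (linked E x y `|` [set w | y = x]).
have Slink : region (~` V) (pairs (~` V)) (linked E x y `|` [set w | y = x]).
  apply: (sigma_algebra_setU RS); first by apply: region_algebra_edge;
    exists x, y.
  exact: (sigma_algebra_constant _ RS).
have avoid w p : K w -> chain w j y p -> forall z, z \in y :: p -> ~ V z.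
  move=> [[_ _ nI] xy] yp z zp Vz; apply: nI; exists x => //.
  have [p' yp' lp'] := chain_prefix zp yp.
  by exists y, p'; rewrite lp'; split=> //; case: xy; [right|left].
have : agree_on K (region (~` V) (pairs (~` V))) [set w | sigma s w y].
  have /choice [B HB] (F : {fset site}) : exists B, [set` F] `<=` ~` V ->
      region (~` V) (pairs (~` V)) B /\
      [set w | sigma s w y] `&` [set w | confined w j y [set` F] /\
        regular_clocks arr w] =
      B `&` [set w | confined w j y [set` F] /\ regular_clocks arr w].
    have [B SB BE] := @agree_spin _ T R E arr sigma0 sigma dl sigma_init
      sigma_jumps sigma_local [set` F] y j s (finite_fset F) s0 (le_trans (ltW
        st) tj).
    exists B => FV; split=> //;
      apply: region_algebra_sub SB => // e [u [v [Fu Fv ->]]].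
    by exists u, v; split=> //; exact: FV.
  have BE (F : {fset site}) w : [set` F] `<=` ~` V -> confined w j y [set` F] ->
      regular_clocks arr w -> (sigma s w y <-> B F w).
    move=> FV cw rw; have [_ /seteqP[E1 E2]] := HB F FV; split=> H1.
      by have [] := E1 w (conj H1 (conj cw rw)).
    by have [] := E2 w (conj H1 (conj cw rw)).
  (* Confinement is tested on chains outside [V] only, to stay in the region; on [K] no other chain
     from [y] exists. *)
  exists (\bigcup_(F in [set: {fset site}]) [set w | [set` F] `<=` ~` V /\
     (B F `&` [set w | forall p, (forall z, z \in y :: p -> ~ V z) ->
        chain w j y p -> [set` F] (last y p)]) w]).
    apply: (sigma_algebra_bigcupT RS) => F; apply: (sigma_algebra_and RS) => FV.
    apply: (sigma_algebra_setI RS); first by case: (HB F FV).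
    exact: (@region_algebra_confined _ T R E arr dl sigma0 (~` V) j y [set` F]).
  apply/seteqP; split=> w [sw Kw]; split=> //.
    have [[reg fin _] xy] := Kw; have [F cF] := fin y.
    pose G := fset_set ([set` F] `\` V).
    have GE : [set` G] = [set` F] `\` V.
      by rewrite fset_setK //; apply: finite_setD; exact: finite_fset.
    have GV : [set` G] `<=` ~` V by rewrite GE => u [].
    have cG : confined w j y [set` G].
      move=> p yp; rewrite GE; split; first exact: cF.
      by apply: (avoid w p Kw yp); rewrite mem_last.
    exists G => //; split=> //; split; first exact/(BE G w GV cG reg).
    by move=> p _; exact: cG.
  case: sw => F _ [FV [BF cF]].
  have [[reg _ _] _] := Kw.
  apply/(BE F w FV _ reg) => //.
  by move=> p yp; apply: cF => //; exact: avoid yp.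
move=> /(spin_true RS)/(_ a)[B SB BE].
exists ((linked E x y `|` [set w | y = x]) `&` B);
  first exact: (sigma_algebra_setI RS).
apply/seteqP; split=> w.
  move=> [[xy [_ sa]] Mw]; split=> //; split=> //.
  by have [] : (B `&` K) w by rewrite -BE.
move=> [[xy Bw] Mw]; split=> //; split=> //; split=> //.
by have [] : ([set w | sigma s w y = a] `&` K) w by rewrite BE.
Qed.

Lemma sigma_algebra_region_past W t : sigma_algebra setT (region_past E sigma W
  t).
Proof. exact: smallest_sigma_algebra. Qed.

Lemma region_past_measurable W t : region_past E sigma W t `<=` measurable.
Proof.
have ST := sigma_algebra_measurable T.
apply: smallest_sub => // A [x _]; move: A; apply: smallest_sub => //.
move=> _ [y [s [a [s0 ->]]]]; apply: (sigma_algebra_setI ST).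
  apply: (sigma_algebra_setU ST).
    by apply: (@region_measurable setT setT); exact: region_algebra_edge.
  exact: (sigma_algebra_constant _ ST).
apply: (sigma_algebra_setI ST);
  first exact: (sigma_algebra_constant (s < t) ST).
case: a; first exact: sigma_measurable.
rewrite [X in measurable X](_ : _ = ~` [set w | sigma s w y]).
  by apply: measurableC; exact: sigma_measurable.
by apply/seteqP; split=> w /=; [move=> ->|move/negP/negbTE].
Qed.

Lemma cylinder_measurable (L0 : {fset site}) (eta : {ffun L0 -> bool}) (t : R) :
  0 <= t -> measurable [set w | forall x : L0, sigma t w (val x) = eta x].
Proof.
move=> t0; apply: (sigma_algebra_forall (sigma_algebra_measurable T)) => x.
case: (eta x); first exact: sigma_measurable.
rewrite [X in measurable X](_ : _ = ~` [set w | sigma t w (val x)]).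
  by apply: measurableC; exact: sigma_measurable.
by apply/seteqP; split=> w /=; [move=> ->|move/negP/negbTE].
Qed.

Let approx (A B N : set T) : measurable A -> measurable B -> measurable N ->
  A `&` ~` N = B `&` ~` N -> `|fine (P A) - fine (P B)| <= fine (P N).
Proof.
have half (X Y Z : set T) : measurable X -> measurable Y -> measurable Z ->
    X `&` ~` Z = Y `&` ~` Z -> fine (P X) <= fine (P Y) + fine (P Z).
  move=> mX mY mZ XYZ; rewrite -fineD ?probability_fin_num // fine_le //.
  - exact: probability_fin_num.
  - by rewrite fin_numD !probability_fin_num.
  apply: le_trans (measureU2 _ mY mZ); apply: le_measure; rewrite ?inE //.
    exact: measurableU.
  move=> w Xw; have [Zw|nZw] := pselect (Z w); [by right|left].
  by have [] : (Y `&` ~` Z) w by rewrite -XYZ.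
move=> mA mB mN ABN; have := half _ _ _ mA mB mN ABN.
have := half _ _ _ mB mA mN (esym ABN).
by rewrite ler_norml; lra.
Qed.

(** [V] is chosen from [L0] and then [F] from [V], both before [B]; this makes the estimate uniform
    in [B] as soon as [L m] contains [V] and [F]. *)
Lemma spatial_mixing (dl_gt0 : 0 < dl) (L0 : {fset site})
    (eta : {ffun L0 -> bool}) (t : R) (L : nat -> {fset site}) :
  0 <= t -> (forall m n, (m <= n)%N -> (L m `<=` L n)%fset) ->
  (forall x : site, exists n, x \in L n) ->
  let A := [set w | forall x : L0, sigma t w (val x) = eta x] in
  forall e, 0 < e -> exists M, forall m, (M <= m)%N ->
  forall B, region_past E sigma (~` [set` L m]) t B ->
    `|fine (P (A `&` B)) - fine (P A) * fine (P B)| <= e.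
Proof.
move=> t0 Lmono Lexh A e e0.
(* The windows of index 0 to [j] cover the times up to [t]. *)
pose j := Num.truncn (t / dl).
have tj : t <= j.+1%:R * dl.
  by rewrite -ler_pdivrMr // ltW // real_truncnS_gt // num_real.
(* Two bad events of probability [e / 6] and a null set make up [N]; replacing [A], [B] and their
   intersection by local events costs at most [P N <= e / 3] each. *)
have e6 : 0 < e / 6 by rewrite divr_gt0.
have [V finV [NA mNA [PNA HNA]]] := confined_finite_set region_measurable
  region_indep eps_gt0 window_le kernel_row j (finite_fset L0) e6.
have [F finF PNB] := influences_finite region_measurable
  region_indep eps_gt0 window_le kernel_row j finV e6.
set NB := [set w | _] in PNB.
have mNB : measurable NB.
  exact: (measurable_influences _ region_measurable j (fun x => ~ F x) V).
have absorb (G : set site) : finite_set G ->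
    exists M, forall m, (M <= m)%N -> G `<=` [set` L m].
  case/finite_seqP=> s ->; elim: s => [|x s [M HM]]; first by exists 0%N.
  have [n xn] := Lexh x; exists (maxn n M) => m;
    rewrite geq_max => /andP[nm Mm].
  move=> y /=; rewrite inE => /predU1P[->|ys]; last exact: HM Mm _ ys.
  by apply: (fsubsetP (Lmono _ _ nm)).
have [M1 HM1] := absorb _ finV; have [M2 HM2] := absorb _ finF.
exists (maxn M1 M2) => m; rewrite geq_max => /andP[/HM1 VL /HM2 FL] B HB.
have [N0 [mN0 PN0 subN0]] : P.-negligible ([set w | ~ regular_clocks arr w] `|`
    [set w | ~ forall y, exists F : {fset site}, confined w j y [set` F]]).
  apply: negligibleU => //.
  rewrite (_ : [set w | _] = \bigcup_y
      [set w | ~ exists F : {fset site}, confined w j y [set` F]]).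
    apply: negligible_bigcup_countable => y.
    exact: (confined_negligible region_measurable region_indep eps_gt0
      window_le kernel_row).
  by apply/seteqP; split=> w; [move=> /existsNP[y ny];
    exists y|case=> y _ ny fin; exact: ny].
pose N := NA `|` NB `|` N0.
have mN : measurable N by apply: measurableU => //; exact: measurableU.
have PN : fine (P N) <= e / 3.
  rewrite -lee_fin fineK ?probability_fin_num //.
  apply: le_trans (measureU2 _ _ mN0) _; first exact: measurableU.
  rewrite [X in (_ + X <= _)%E]PN0 adde0;
    apply: le_trans (measureU2 _ mNA mNB) _.
  rewrite (_ : e / 3 = e / 6 + e / 6); last by field.
  by rewrite EFinD; exact: leeD.
have mA : measurable A by exact: cylinder_measurable.
have mB := region_past_measurable HB.
have regN w : ~ N w -> regular_clocks arr w.
  by move=> /not_orP[_ nN0]; apply: contrapT => nreg; apply/nN0/subN0; left.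
have [A' SA' AA'] : agree_on (~` N) (region V (pairs V)) A.
  have RS := @sigma_algebra_region _ T R E arr sigma0 V (pairs V).
  apply: (sigma_algebra_forall (sigma_algebra_agree_on (~` N) RS)) => x.
  apply: spin_true => //.
  apply: agree_on_sub (@agree_spin _ T R E arr sigma0 sigma dl sigma_init
      sigma_jumps sigma_local V (val x) j t finV t0 tj).
  move=> w nN; split; last exact: regN.
  by move: nN => /not_orP[/not_orP[nNA _] _]; apply: HNA => //; exact: valP x.
have WV : ~` [set` L m] `&` V = set0.
  by apply/seteqP; split=> x // [nLx /VL].
have [B' SB' BB'] : agree_on (~` N) (region (~` V) (pairs (~` V))) B.
  apply: agree_on_sub (region_past_agree tj WV HB) => w nN; split.
  - exact: regN.
  - move: nN => /not_orP[_ nN0]; apply: contrapT => nfin.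
    by apply/nN0/subN0; right.
  - move: nN => /not_orP[/not_orP[_ nNB] _] [x nLx xV]; apply: nNB.
    by exists x => // /FL.
have pairsV : pairs V `&` pairs (~` V) = set0.
  apply/seteqP; split=> f // [[u [v [Vu Vv ->]]] [u' [v' [Vu' Vv']]]].
  move=> /fsetP /(_ u); rewrite !inE eqxx /= => /esym /orP[/eqP uu'|/eqP uv'].
    by apply: Vu'; rewrite -uu'.
  by apply: Vv'; rewrite -uv'.
have indep : fine (P (A' `&` B')) = fine (P A') * fine (P B').
  rewrite (region_indep _ pairsV SA' SB') ?setICr // fineM //.
  - by apply: probability_fin_num; exact: region_measurable SA'.
  - by apply: probability_fin_num; exact: region_measurable SB'.
have mA' := region_measurable SA'; have mB' := region_measurable SB'.
have dA := approx mA mA' mN AA'; have dB := approx mB mB' mN BB'.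
have dAB : `|fine (P (A `&` B)) - fine (P (A' `&` B'))| <= fine (P N).
  apply: approx => //; [exact: measurableI|exact: measurableI|].
  by rewrite -(setIid (~` N)) setIACA AA' BB' setIACA.
have p01 (X : set T) : measurable X -> 0 <= fine (P X) <= 1.
  move=> mX; rewrite fine_ge0 //=.
  rewrite -lee_fin fineK ?probability_fin_num //; exact: probability_le1.
have /andP[A0 A1] := p01 _ mA; have /andP[B0 B1] := p01 _ mB'.
rewrite indep in dAB.
have -> : fine (P (A `&` B)) - fine (P A) * fine (P B) =
  (fine (P (A `&` B)) - fine (P A') * fine (P B')) +
  ((fine (P A') - fine (P A)) * fine (P B') +
   fine (P A) * (fine (P B') - fine (P B))) by ring.
apply: (le_trans (ler_normD _ _)).
rewrite (_ : e = e / 3 + (e / 3 + e / 3)); last by field.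
apply: lerD; first exact: le_trans dAB PN.
apply: (le_trans (ler_normD _ _)); apply: lerD; rewrite normrM.
  rewrite [X in _ * X]ger0_norm // distrC.
  by apply: le_trans PN; apply: le_trans dA; rewrite ler_piMr.
rewrite [X in X * _]ger0_norm // distrC.
by apply: le_trans PN; apply: le_trans dB; rewrite ler_piMl.
Qed.

End Mixing.

(** * Passage from the assumptions of the theorem to the mixing estimate *)

Lemma sigma_algebra_preimage_in {U V : Type} (g : U -> V) (S : set (set U)) :
  sigma_algebra setT S -> sigma_algebra setT [set Q | S (g @^-1` Q)].
Proof.
move=> SS; split=> /=.
- by rewrite preimage_set0; case: SS.
- by move=> Q SQ; rewrite setTD preimage_setC; exact: sigma_algebra_setC.
- by move=> Q SQ; rewrite preimage_bigcup; case: SS => _ _; apply.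
Qed.

Lemma regular_clocks_negligible {d : measure_display} {T : measurableType d}
    {R : realType} (P : probability T R) (arr : site -> nat -> T -> R) :
  (forall x, poisson_process P 1 (arr x)) ->
  P.-negligible [set w | ~ regular_clocks arr w].
Proof.
move=> arr_poisson.
(* Positive integer bounds suffice for unboundedness and leave a countable union of null sets. *)
pose bad (z : site * nat) := [set w | ~ ((forall m n, (m <= n)%N ->
  arr z.1 m w <= arr z.1 n w) /\ exists n, z.2.+1%:R < arr z.1 n w)].
apply: (@negligibleS _ _ _ _ (\bigcup_z bad z)); last first.
  by apply: negligible_bigcup_countable => z; exact: poisson_arrivals_regular.
move=> w /= /existsNP[x nx]; apply: contrapT => nbad; apply: nx.
have good k : (forall m n, (m <= n)%N -> arr x m w <= arr x n w) /\
    exists n, k.+1%:R < arr x n w.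
  by apply: contrapT => nk; apply: nbad; exists (x, k).
split; first by have [] := good 0%N.
move=> u; have [_ [n kn]] := good (Num.truncn u); exists n.
by apply: lt_trans kn; rewrite real_truncnS_gt // num_real.
Qed.

Theorem theorem2
  (R : realType) (d : measure_display) (T : measurableType d)
  (P : probability T R)
  (* the random graph *)
  (E : T -> set {fset site}) (C : R)
  (* arrival times of the Poisson processes *)
  (arr : site -> nat -> T -> R)
  (* initial configuration, graphical construction, process *)
  (sigma0 : T -> conf) (H : set (set T)) (X : conf -> R -> T -> conf)
  (sigma : R -> T -> conf)
  (* context: the graph *)
  (E_simple : forall w e, E w e -> #|` e|%fset = 2%N)
  (E_nn : forall x y : site, dist x y = 1%N ->
     P (linked E x y) = 1%E)
  (C_gt0 : 0 < C)
  (E_long : forall x y : site, (1 < dist x y)%N ->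
     (P (linked E x y) <= (C / (dist x y)%:R ^+ 9)%:E)%E)
  (* context: initial law, coupling and independence *)
  (sigma0_law : symmetric_bernoulli P sigma0)
  (H_algebra : sigma_algebra setT H)
  (H_measurable : H `<=` measurable)
  (H_graph : graph_algebra E `<=` H)
  (H_clock : forall x, clock_algebra (arr x) `<=` H)
  (sigma0_indep : independent2 P (init_algebra sigma0) H)
  (clock_indep : independent2 P
     (<<s \bigcup_x clock_algebra (arr x) >>)
     (<<s init_algebra sigma0 `|` graph_algebra E >>))
  (X_graphical : graphical_construction H X)
  (sigmaE : forall t w, sigma t w = X (sigma0 w) t w)
  (* (i) *)
  (arr_poisson : forall x, poisson_process P 1 (arr x))
  (arr_indep : independent_algebras P (fun x => clock_algebra (arr x)))
  (sigma_jumps : forall w x (s t : R), 0 <= s -> s <= t ->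
     (forall n, ~ (s < arr x n w /\ arr x n w <= t)) ->
     sigma t w x = sigma s w x)
  (* (ii) *)
  (E_measurable : forall x y : site, measurable (linked E x y))
  (E_indep : independent_events P (fun e => [set w | E w e]))
  (* (iii) *)
  (sigma_local : forall x n,
     local_past E sigma x (arr x n) [set w | sigma (arr x n w) w x])
  (* (iv) *)
  (E_invariant : forall x y v : site,
     P (linked E x y) = P (linked E (x + v) (y + v)))
  (X_invariant : forall (t : R) (v : site) (eta : conf) (A : set conf),
     0 <= t -> conf_algebra A ->
     P [set w | A (X eta t w)] =
     P [set w | (conf_shift v @` A) (X (conf_shift v eta) t w)])
  :
  forall (L0 : {fset site}) (eta : {ffun L0 -> bool}) (t : R),
    0 <= t ->
  forall L : nat -> {fset site},
    (forall m n, (m <= n)%N -> (L m `<=` L n)%fset) ->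
    (forall x : site, exists n, x \in L n) ->
  let A := [set w | forall x : L0, sigma t w (val x) = eta x] in
  forall f : nat -> T -> R,
    (forall n, is_cond_probability P
       (region_past E sigma (~` [set` L n]) t) A (f n)) ->
    {ae P, forall w, f n w @[n --> \oo] --> fine (P A)}.
Proof.
move=> L0 eta t t0 L Lmono Lexh A f fP.
have graph_measurable : graph_algebra E `<=` measurable.
  exact: subset_trans H_graph H_measurable.
have clock_measurable x : clock_algebra (arr x) `<=` measurable.
  exact: subset_trans (H_clock x) H_measurable.
have sigma0_graph : independent2 P (init_algebra sigma0) (graph_algebra E).
  exact: independent2_sub H_graph sigma0_indep.
have region_measurable := region_algebra_measurable sigma0_law graph_measurable
  clock_measurable.
have region_indep := region_algebra_independent sigma0_law graph_measurable
  clock_measurable sigma0_graph clock_indep arr_indep E_indep.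
set K := Num.max 1 C.
have K_ge1 : 1 <= K by rewrite le_max lexx.
(* Link probabilities from a site sum to at most [144 * K] and [eps <= dl], so the kernel has row
   sums at most [2 * dl * (144 * K) = 1 / 2]. *)
pose dl : R := (576 * K)^-1.
have dl_gt0 : 0 < dl by rewrite invr_gt0 pmulr_rgt0 ?ltr0n // (lt_le_trans _
  K_ge1).
pose eps : R := 1 - expR (- dl).
have eps_gt0 : 0 < eps by rewrite subr_gt0 expR_lt1 oppr_lt0.
have eps_le : eps <= dl by have := expR_ge1Dx (- dl); rewrite /eps; lra.
have window_le x i : (P (window arr dl x i) <= eps%:E)%E.
  have := poisson_arrival_window (arr_poisson x) (mulr_ge0 (ler0n _ i) (ltW
    dl_gt0))
    (ltW dl_gt0).
  congr (P _ <= _)%E; apply/seteqP; split=> w [n itv]; exists n.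
    by rewrite -natr1 mulrDl mul1r.
  by move: itv; rewrite -natr1 mulrDl mul1r.
have mlinked x y : measurable (linked E x y) by exact: E_measurable.
have kernel_row x :
    (\esum_(y in [set: site]) (chain_kernel P E eps x y)%:E <= (2^-1)%:E)%E.
  have link_ge0 y : 0 <= link_prob P E x y by apply: fine_ge0;
    exact: measure_ge0.
  under eq_esum do rewrite /chain_kernel EFinM.
  apply: le_trans (esum_mull_le _ _ _) _.
  - by rewrite lee_fin mulr_ge0 // ltW.
  - by move=> y; rewrite lee_fin.
  apply: (@le_trans _ _ ((2 * eps)%:E * (144 * K)%:E)%E).
    apply: lee_wpmul2l; first by rewrite lee_fin mulr_ge0 // ltW.
    apply: esum_site_le => // [|y _|y xy].
    (* The pair of [x] with itself has one element, whereas edges have two. *)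
    - rewrite /link_prob (_ : linked E x x = set0) ?measure0 //.
      apply/seteqP; split=> w // /E_simple.
      by rewrite fsetUid cardfs1.
    - rewrite -lee_fin fineK ?probability_fin_num //; exact: probability_le1.
    - by rewrite -lee_fin fineK ?probability_fin_num //; exact: E_long.
  rewrite -EFinM lee_fin.
  apply: (@le_trans _ _ (2 * dl * (144 * K))).
    by rewrite ler_wpM2r ?ler_wpM2l ?mulr_ge0 ?ler0n ?(le_trans _ K_ge1).
  rewrite /dl le_eqVlt; apply/orP; left; apply/eqP; field.
  by apply: lt0r_neq0; exact: lt_le_trans K_ge1.
have sigma_init w : sigma 0 w = sigma0 w by rewrite sigmaE; case: X_graphical.
have sigma_measurable s x : 0 <= s -> measurable [set w | sigma s w x].
  (* The spin is the jointly measurable map [X] composed with [w] mapped to [(sigma0 w, w)]. *)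
  move=> s0; have [_ /(_ s x s0) QX] := X_graphical.
  have -> : [set w | sigma s w x] =
      (fun w => (sigma0 w, w)) @^-1` [set p | X p.1 s p.2 x].
    by apply/seteqP; split=> w /=; rewrite sigmaE.
  have preimage_init V (g : T -> V) :=
    sigma_algebra_preimage_in g (sigma_algebra_measurable T).
  move: QX; apply: (smallest_sub (preimage_init _ (fun w => (sigma0 w, w)))).
  move=> _ [D [B [cD HB ->]]].
  apply: (@measurableI _ T (sigma0 @^-1` D) B); last exact: H_measurable.
  move: cD; apply: (smallest_sub (preimage_init _ sigma0)).
  by move=> _ [y ->]; case: sigma0_law => ms _ _; exact: ms.
have regular : P.-negligible [set w | ~ regular_clocks arr w].
  exact: regular_clocks_negligible.
apply: (cond_probability_mixing_cvg (F := fun n =>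
  region_past E sigma (~` [set` L n]) t)) => //.
- by move=> n; exact: sigma_algebra_region_past.
- by move=> n; exact: (region_past_measurable region_measurable).
- move=> m n mn; apply: sub_sigma_algebra2 => B [x nLx Bx]; exists x => // Lx.
  by apply: nLx; exact: (fsubsetP (Lmono _ _ mn)).
- exact: (cylinder_measurable sigma_measurable).
- exact: (spatial_mixing region_measurable region_indep eps_gt0 window_le
  kernel_row).
Qed.
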